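(* Let $r=r(n)$ be positive integers with $r<n/2$, and write $r=c_n n^{1/3}$. Run the random process described in the context, producing the final intersecting family $\mathcal F$, and let $\mathcal E_{n,r}$ be the event that $|\mathcal F|=\binom{n-1}{r-1}$ (for $r<n/2$ this is equivalent to the existence of some $x\in[n]$ contained in every member of $\mathcal F$). Then $$\lim_{n\to\infty}\Pr(\mathcal E_{n,r})=\begin{cases}1 & \text{if } c_n\to 0,\\ \dfrac{1}{1+c^3} & \text{if } c_n\to c\in(0,\infty),\\ 0 & \text{if } c_n\to\infty.\end{cases}$$
   Context: Random intersecting process: Let $[n]=\{1,\dots,n\}$ and $\binom{[n]}{r}$ the family of $r$-subsets of $[n]$. Choose $e_1$ uniformly at random from $\binom{[n]}{r}$. Given $\mathcal F_i=\{e_1,\dots,e_i\}$, let $\mathcal A(\mathcal F_i)=\{e\in\binom{[n]}{r}: e\notin\mathcal F_i,\ e\cap e_j\neq\emptyset \text{ for all } 1\le j\le i\}$, and choose $e_{i+1}$ uniformly at random from $\mathcal A(\mathcal F_i)$. The process halts when $\mathcal A(\mathcal F_i)=\emptyset$ and outputs $\mathcal F=\mathcal F_i$. All limits are as $n\to\infty$. *)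

(* Defs.v *)
From HB Require Import structures.
From mathcomp Require Import all_boot all_order all_algebra.
Set Implicit Arguments. Unset Strict Implicit. Unset Printing Implicit Defensive.
Import GRing.Theory Num.Theory.

Section Process.
Local Open Scope ring_scope.
Variables n r : nat.

Definition rsets : {set {set 'I_n}} := [set e : {set 'I_n} | #|e| == r].

Definition avail (F : {set {set 'I_n}}) : {set {set 'I_n}} :=
  [set e in rsets | (e \notin F) && [forall f in F, e :&: f != set0]].

(* Probability (exactly, in rat) that the process started from the family F
   halts with a final family of size 'C(n-1, r-1).  [k] is fuel. *)
Fixpoint pstar_from (k : nat) (F : {set {set 'I_n}}) : rat :=
  match k with
  | 0 => 0%R
  | k'.+1 =>
      if avail F == set0 then (((#|F| == 'C(n.-1, r.-1))%N : nat)%:R)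
      else ((#|avail F|%:R)^-1 * \sum_(e in avail F) pstar_from k' (e |: F))%R
  end.

(* Each step adds a new r-set, so 'C(n,r).+1 units of fuel always suffice. *)
Definition prob_star_rat : rat := pstar_from ('C(n, r)).+1 set0.
End Process.

From Stdlib Require Import Reals.

Definition int_to_R (z : int) : R :=
  match z with
  | Posz m => INR m
  | Negz m => (- (INR m + 1))%R
  end.

Definition rat_to_R (q : rat) : R := (int_to_R (numq q) / int_to_R (denq q))%R.

Definition prob_star (n r : nat) : R := rat_to_R (prob_star_rat n r).

(* Main.v *)
(** Let N = C(n-1, r-1) and L = C(n-2, r-2). By the uniqueness part of the
    Erdős–Ko–Rado theorem a family of size N is a star, so the probability in
    question is 0 as soon as the chosen sets have no common point.

    If r^2 / n is small, then e_1 and e_2 meet in a single point x with probability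
    1 - O(r^2/n). Next to the N sets containing x there are about (r-1)^2 L r-sets
    that avoid x and meet both e_1 and e_2, so e_3 contains x with probability about
    1 / (1 + (r-1)^3/(n-1)). Each set avoiding x that is still admissible meets a
    random member of the star at x with probability O(r^2/n), so after e_3 the
    process stays in the star up to probability O(r^2/n). Hence the probability of
    a star is 1 / (1 + (r-1)^3/(n-1)) + O(r^2/n) for every r, which settles
    c_n -> c >= 0 because r^3/n = c_n^3.

    If c_n -> oo, the probability is at most the expected number of points common to
    the first m sets. For r <= n^(3/5) three sets are enough, with error O(n/r^3) or
    O(r^3/n^2). For larger r almost every r-set meets all sets chosen so far, and the
    expectation shrinks by a factor 3/4 in each of the first r^2/(6n) steps.

    EKR uniqueness is proved by Katona's cycle method: every cyclic order has exactly
    r arcs in F. In terms of sets this says that if A in F is split as B + C and D, E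
    are disjoint sets outside A with |D| = |B|, |E| = |C|, then exactly one of C + D
    and B + E is in F, and this exchange property forces a star. *)

Require Import Defs.
From Stdlib Require Reals Lra Lia Psatz Classical_Prop.
From mathcomp Require all_boot all_order all_algebra all_fingroup.
From mathcomp Require zify ring lra Rstruct.

Module FiniteProcess.
Import all_boot all_order all_algebra all_fingroup zify ring lra.
Set Implicit Arguments. Unset Strict Implicit. Unset Printing Implicit Defensive.
Import Order.TTheory GRing.Theory Num.Theory.

(** * Uniqueness in the Erdős–Ko–Rado theorem *)

Lemma exists_subset_card (T : finType) (U : {set T}) k :
  k <= #|U| -> exists2 D : {set T}, D \subset U & #|D| = k.
Proof.
move=> lekU; exists [set x in take k (enum U)].
  by apply/subsetP=> x; rewrite inE => /mem_take; rewrite mem_enum.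
rewrite cardsE (card_uniqP _) ?take_uniq ?enum_uniq //.
by rewrite size_takel // -cardE.
Qed.

Lemma exists_disjoint_subsets (T : finType) (U : {set T}) k l :
  k + l <= #|U| -> exists D E : {set T},
    [/\ D \subset U, E \subset U, [disjoint D & E], #|D| = k & #|E| = l].
Proof.
move=> leklU; have [|D sDU cD] := @exists_subset_card T U k; first by lia.
have [|E sE cE] := @exists_subset_card T (U :\: D) l.
  by have := cardsD U D; rewrite (setIidPr sDU); lia.
exists D, E; split=> //; first exact: subset_trans sE (subsetDl _ _).
by rewrite disjoint_sym; apply: disjointWl sE _; rewrite disjoints_subset setDE subsetIr.
Qed.

(** The positions [i0 + t] with [r <= t <= n - r] are excluded by [i0]. The others, apart from [i0],
    form [r - 1] pairs at distance [n - r], and a pair holds at most one chosen position. A total of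
    [r] therefore leaves no pair empty. *)
Lemma katona_cycle n r i0 (g : nat -> bool) :
  0 < r -> r.*2 <= n -> (forall i, g (i + n) = g i) ->
  (forall i d, r <= d <= n - r -> g i -> ~~ g (i + d)) -> g i0 ->
  \sum_(i < n) g i <= r /\
  (\sum_(i < n) g i = r ->
   forall k, 0 < k < r -> g (i0 + k) != g (i0 + (n - r + k))).
Proof.
move=> r_gt0 le2rn gn gd g0.
(* By periodicity the window of length [n] may start at [i0]. *)
have shift : \sum_(i < n) g i = \sum_(0 <= t < n) g (i0 + t).
  rewrite -(big_mkord xpredT (fun i => g i : nat)).
  elim: i0 {g0} => [|i IHi]; first exact: eq_bigr.
  rewrite {}IHi; case: n {le2rn gd} gn => [|n] gn; first by rewrite !big_nil.
  rewrite big_nat_recl // addn0 [in RHS]big_nat_recr //= addSnnS gn addnC.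
  by congr (_ + _); apply: eq_bigr => t _; rewrite addSnnS.
set f := fun k => g (i0 + k) + g (i0 + (n - r + k)).
have split3 : \sum_(i < n) g i = 1 + \sum_(1 <= k < r) f k.
  rewrite shift (@big_cat_nat _ _ _ r) //=; last by lia.
  rewrite (@big_cat_nat _ _ _ (1 + (n - r)) r n) //=; [|lia|lia].
  rewrite [X in _ + (X + _) = _]big_nat_cond [X in _ + (X + _) = _]big1.
    rewrite big_addn subKn; last by lia.
    rewrite add0n (big_ltn r_gt0) addn0 g0 -addnA -big_split /=; congr (_ + _).
    by apply: eq_bigr => k _; rewrite /f (addnC k).
  move=> t /andP[/andP[h1 h2] _]; apply/eqP; rewrite eqb0.
  by apply: gd g0; lia.
have f1 k : f k <= 1.
  rewrite /f; case e : (g (i0 + k)); last by case: (g _).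
  suff /negbTE-> : ~~ g (i0 + (n - r + k)) by [].
  have -> : i0 + (n - r + k) = i0 + k + (n - r) by lia.
  by apply: gd e; lia.
have sf : \sum_(1 <= k < r) f k + \sum_(1 <= k < r) (1 - f k) = r.-1.
  rewrite -big_split /=; under eq_bigr do rewrite subnKC ?f1 //.
  by rewrite sum_nat_const_nat; lia.
split; first by lia.
move=> eqr k /andP[k_gt0 ltkr].
have /eqP : \sum_(1 <= k < r) (1 - f k) = 0 by lia.
rewrite sum_nat_seq_eq0 => /allP/(_ k); rewrite mem_index_iota k_gt0 ltkr.
move=> /(_ isT)/=; rewrite subn_eq0 /f.
by have := f1 k; rewrite /f; case: (g (i0 + k)); case: (g _).
Qed.

(** * Counting permutations by the image of a fixed set *)

Section PermCount.
Variable n : nat.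

Lemma perm_of_uniq (s : seq 'I_n) (x0 : 'I_n) :
  uniq s -> size s = n -> exists p : {perm 'I_n}, forall i : 'I_n, p i = nth x0 s i.
Proof.
move=> us ss.
have inj : injective (fun i : 'I_n => nth x0 s i).
  move=> i j /eqP; rewrite nth_uniq ?ss ?ltn_ord // => /eqP; exact: val_inj.
by exists (perm inj) => i; rewrite permE.
Qed.

(** Both sets are images of the same initial segment: list the set first and its complement after
    it. *)
Lemma perm_imset_ex (A B : {set 'I_n}) :
  #|A| = #|B| -> exists p : {perm 'I_n}, p @: A = B.
Proof.
move=> eqAB.
have [n0|n_gt0] := posnP n.
  exists 1%g; suff E (C : {set 'I_n}) : C = set0 by rewrite (E B) (E (_ @: _)).
  by apply/setP=> -[i lti]; exfalso; move: lti; rewrite n0.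
pose x0 := Ordinal n_gt0.
have H (C : {set 'I_n}) : exists p : {perm 'I_n},
    p @: [set i : 'I_n | i < #|C|] = C.
  have us : uniq (enum C ++ enum (~: C)).
    rewrite cat_uniq !enum_uniq andbT; apply/hasPn => x.
    by rewrite mem_enum inE /= mem_enum.
  have ss : size (enum C ++ enum (~: C)) = n.
    by rewrite size_cat -!cardE cardsC card_ord.
  have [p pE] := perm_of_uniq x0 us ss.
  have lec : #|C| <= n by rewrite -[X in _ <= X]card_ord max_card.
  exists p; apply/eqP; rewrite eqEcard card_imset; last exact: perm_inj.
  apply/andP; split.
    apply/subsetP=> _ /imsetP[i + ->]; rewrite inE pE nth_cat -cardE => ltic.
    by rewrite ltic -mem_enum mem_nth // -cardE.
  rewrite -sum1dep_card -(big_ord_widen _ (fun=> 1) lec) sum1_card card_ord.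
  exact: leqnn.
have [p pA] := H A; have [q qB] := H B.
exists (p^-1 * q)%g; rewrite -[in LHS]pA -imset_comp -[RHS]qB -eqAB.
by apply: eq_imset => x; rewrite /= permM permK.
Qed.

(** Composing with a permutation that carries [A] to [B] shows that every r-set is the image of [A0]
    under equally many permutations, namely n! / C(n, r). *)
Lemma card_perm_imset_in r (A0 : {set 'I_n}) (F : {set {set 'I_n}}) :
  #|A0| = r -> F \subset rsets n r ->
  #|[set p : {perm 'I_n} | p @: A0 \in F]| * 'C(n, r) = #|F| * n`!.
Proof.
move=> cA0 sF.
pose N A := #|[set p : {perm 'I_n} | p @: A0 == A]|.
have sumN (G : {set {set 'I_n}}) :
    #|[set p : {perm 'I_n} | p @: A0 \in G]| = \sum_(A in G) N A.
  rewrite -sum1dep_card (partition_big (fun p : {perm 'I_n} => p @: A0) (mem G)) //=.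
  apply: eq_bigr => A AG; rewrite /N -sum1dep_card; apply: eq_bigl => p.
  by case: eqP => [->|]; rewrite ?AG ?andbF.
have eqN (A B : {set 'I_n}) : #|A| = r -> #|B| = r -> N A = N B.
  move=> cA cB; have [q qA] := @perm_imset_ex A B (etrans cA (esym cB)).
  rewrite /N -(card_imset _ (mulIg q)); apply: eq_card => p.
  apply/imsetP/idP => [[p'] |].
    rewrite !inE => /eqP pA ->; rewrite -qA -pA -imset_comp.
    by apply/eqP/eq_imset => x /=; rewrite permM.
  rewrite inE => /eqP pB; exists (p * q^-1)%g; last by rewrite mulgKV.
  rewrite inE; apply/eqP/(imset_inj (@perm_inj _ q)).
  rewrite qA -pB -imset_comp; apply: eq_imset => x /=.
  by rewrite permM permKV.
have tot : n`! = 'C(n, r) * N A0.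
  have := sumN (rsets n r); rewrite (eq_bigr (fun=> N A0)); last first.
    by move=> A; rewrite inE => /eqP cA; apply: eqN.
  rewrite sum_nat_const /rsets card_draws card_ord => <-.
  have -> : [set p : {perm 'I_n} | p @: A0 \in rsets n r] = [set: {perm 'I_n}].
    apply/setP=> p; rewrite !inE card_imset; last exact: perm_inj.
    by rewrite cA0 eqxx.
  by rewrite cardsT card_Sn.
rewrite sumN (eq_bigr (fun=> N A0)) => [|A /(subsetP sF)]; last first.
  by rewrite inE => /eqP cA; apply: eqN.
by rewrite sum_nat_const tot -mulnA (mulnC (N A0)).
Qed.

End PermCount.

(** The case [e = f] is included, so the empty set is not a member. *)
Definition intersecting n (F : {set {set 'I_n}}) :=
  forall e f, e \in F -> f \in F -> e :&: f != set0.

(** * Katona's cycle method *)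

Section Katona.
Variables (n r : nat) (F : {set {set 'I_n}}).
Hypotheses (r_gt0 : 0 < r) (le2rn : r.*2 <= n).
Hypotheses (sF : F \subset rsets n r) (iF : intersecting F).
Hypothesis cF : #|F| = 'C(n.-1, r.-1).

Let n_gt0 : 0 < n. Proof. by lia. Qed.
Let pos i : 'I_n := Ordinal (ltn_pmod i n_gt0).
Let arc i : {set 'I_n} := [set pos (i + k) | k : 'I_r].

Let card_arc i : #|arc i| = r.
Proof.
rewrite card_imset ?card_ord // => k l /(congr1 val)/= /eqP.
rewrite eqn_modDl !modn_small; [| by have := ltn_ord l; lia | by have := ltn_ord k; lia].
by move/eqP; apply: val_inj.
Qed.

Let arcDn i : arc (i + n) = arc i.
Proof.
apply: eq_imset => k; apply: val_inj => /=.
by rewrite -addnA (addnC n) addnA modnDr.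
Qed.

Let disjoint_arc i d : r <= d <= n - r -> arc i :&: arc (i + d) = set0.
Proof.
move=> ltd; apply/setP=> x; rewrite in_set0 inE; apply/negbTE/negP.
move=> /andP[/imsetP[k _ ->] /imsetP[l _ /(congr1 val)/= /eqP]].
rewrite -addnA eqn_modDl !modn_small; [| by have := ltn_ord l; lia | by have := ltn_ord k; lia].
by have := ltn_ord k; lia.
Qed.

(** A permutation [p] is read as the cyclic order with [p j] at position [j]. *)
Let arcs_in_F (p : {perm 'I_n}) i := p @: arc i \in F.

Let arcs_disj p i d : r <= d <= n - r -> arcs_in_F p i -> ~~ arcs_in_F p (i + d).
Proof.
move=> ltd Fi; apply/negP=> Fid; have := iF Fi Fid.
rewrite -imsetI; last by move=> ? ? _ _; apply: perm_inj.
by rewrite disjoint_arc // imset0 eqxx.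
Qed.

Let arcs_per p i : arcs_in_F p (i + n) = arcs_in_F p i.
Proof. by rewrite /arcs_in_F arcDn. Qed.

Let sum_arcs_le p : \sum_(i < n) arcs_in_F p i <= r.
Proof.
have [/existsP[i Fi]|/existsPn nF] := boolP [exists i : 'I_n, arcs_in_F p i].
  by have [] := katona_cycle r_gt0 le2rn (arcs_per p) (@arcs_disj p) Fi.
by rewrite big1 // => i _; apply/eqP; rewrite eqb0.
Qed.

(* No cyclic order has more than r arcs in F, and the average over all orders is r. *)
Let sum_arcs_eq p : \sum_(i < n) arcs_in_F p i = r.
Proof.
(* Double counting: each of the [n] arcs lands in [F] for |F| n! / C(n, r) permutations, and n
   C(n-1, r-1) = r C(n, r). *)
have tot : (\sum_(q : {perm 'I_n}) \sum_(i < n) arcs_in_F q i) * 'C(n, r)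
           = (\sum_(q : {perm 'I_n}) r) * 'C(n, r).
  rewrite exchange_big /= big_distrl /=.
  under eq_bigr => i _.
    rewrite -big_mkcond sum1dep_card (card_perm_imset_in (card_arc i) sF).
    over.
  rewrite sum_nat_const card_ord cF sum_nat_const.
  have -> : #|{perm 'I_n}| = n`! by rewrite -card_Sn; apply: eq_card.
  have := mul_bin_diag n r.-1; rewrite prednK // => e.
  by rewrite mulnA e mulnC mulnA.
have /eqP := tot; rewrite eqn_pmul2r ?bin_gt0; last by lia.
move=> /eqP tot'.
have := leqif_sum (fun (q : {perm 'I_n}) (_ : true) => leqif_eq (sum_arcs_le q)).
by move=> [_ /esym]; rewrite tot' eqxx => /forallP/(_ p)/eqP.
Qed.

(** Take the cyclic order that lists [B], [A :\: B], [D], the remaining points and [E]. The arcs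
    starting at 0, [#|B|] and [n - r + #|B|] are [A], [A :\: B :|: D] and, wrapping around, [E]
    followed by [B]. The last two form one of the pairs of [katona_cycle]. *)
Lemma katona_exchange (A B D E : {set 'I_n}) :
  A \in F -> B \subset A -> 0 < #|B| < r -> D \subset ~: A -> E \subset ~: A ->
  [disjoint D & E] -> #|D| = #|B| -> #|E| = r - #|B| ->
  (A :\: B :|: D \in F) != (B :|: E \in F).
Proof.
move=> AF sBA /andP[B_gt0 ltBr] sDA sEA dDE cD cE.
have cA : #|A| = r by have /(subsetP sF) := AF; rewrite inE => /eqP.
have cC : #|A :\: B| = r - #|B| by rewrite cardsD (setIidPr sBA) cA.
pose R := ~: (A :|: D :|: E).
have DA x : x \in D -> x \in A = false by move/(subsetP sDA); rewrite inE => /negbTE.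
have EA x : x \in E -> x \in A = false by move/(subsetP sEA); rewrite inE => /negbTE.
have BA x : x \in B -> x \in A by move/(subsetP sBA).
have DE x : x \in D -> x \in E = false by move=> xD; rewrite (disjointFr dDE).
pose s := enum B ++ enum (A :\: B) ++ enum D ++ enum R ++ enum E.
have mems x : x \in s.
  rewrite /s !mem_cat !mem_enum !inE.
  by case: (x \in A); case: (x \in B); case: (x \in D); case: (x \in E).
have cR : #|R| = n - r.*2.
  have d1 : A :&: D = set0 by apply: disjoint_setI0; rewrite disjoint_sym disjoints_subset.
  have d2 : (A :|: D) :&: E = set0.
    apply: disjoint_setI0; rewrite disjoint_sym disjoints_subset.
    by apply/subsetP => x xE; rewrite !inE EA //=; apply/negP => /DE; rewrite xE.
  by rewrite cardsCs setCK card_ord !cardsU d1 d2 !cards0; lia.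
have ss : size s = n by rewrite /s !size_cat -!cardE; lia.
have us : uniq s.
  apply: (@leq_size_uniq _ (enum 'I_n)); first exact: enum_uniq.
    by move=> x _; apply: mems.
  by rewrite ss size_enum_ord.
have [p pE] := perm_of_uniq (pos 0) us ss.
have lt_idx x : index x s < n by rewrite -[X in _ < X]ss index_mem mems.
have in_arc i x : (exists2 k, k < r & (i + k) %% n = index x s) -> x \in p @: arc i.
  move=> [k ltk ek]; apply/imsetP; exists (pos (i + k)).
    by apply/imsetP; exists (Ordinal ltk).
  by rewrite pE /= ek nth_index.
have arcP i (X : {set 'I_n}) : #|X| = r ->
    (forall x, x \in X -> exists2 k, k < r & (i + k) %% n = index x s) -> p @: arc i = X.
  move=> cX sX; apply/esym/eqP; rewrite eqEcard card_imset; last exact: perm_inj.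
  by rewrite card_arc cX leqnn andbT; apply/subsetP => x /sX; apply: in_arc.
have size_enum (X : {set 'I_n}) : size (enum X) = #|X| by rewrite -cardE.
have idxB x : x \in B -> index x s < #|B|.
  by move=> xB; rewrite /s index_cat mem_enum xB -size_enum index_mem mem_enum.
have idxC x : x \in A :\: B -> #|B| <= index x s < r.
  move=> xC; rewrite /s index_cat mem_enum; move: (xC); rewrite inE => /andP[/negbTE-> _].
  rewrite index_cat mem_enum xC size_enum leq_addr /=.
  have : index x (enum (A :\: B)) < r - #|B| by rewrite -cC -size_enum index_mem mem_enum.
  by rewrite ltn_subRL.
have idxD x : x \in D -> r <= index x s < r + #|B|.
  move=> xD; have xA := DA _ xD.
  have xB : x \in B = false by apply/negbTE; apply: contraFN xA; apply: BA.
  rewrite /s index_cat mem_enum xB index_cat mem_enum inE xA andbF index_cat mem_enum xD.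
  rewrite !size_enum cC.
  have : index x (enum D) < #|B| by rewrite -cD -size_enum index_mem mem_enum.
  by move: (index _ _) #|B| ltBr => j b ltb; clear -ltb; lia.
have idxE x : x \in E -> n - r + #|B| <= index x s.
  move=> xE; have xA := EA _ xE.
  have xB : x \in B = false by apply/negbTE; apply: contraFN xA; apply: BA.
  have xD : x \in D = false by apply/negbTE; apply/negP => /DE; rewrite xE.
  have xR : x \in R = false by rewrite !inE xE orbT.
  rewrite /s index_cat mem_enum xB index_cat mem_enum inE xA andbF index_cat mem_enum xD.
  rewrite index_cat mem_enum xR.
  rewrite !size_enum cC cD cR; move: (index _ _) #|B| ltBr => j b ltb.
  by clear -ltb le2rn; lia.
have A0 : p @: arc 0 = A.
  apply: arcP => // x xA; exists (index x s); last by rewrite add0n modn_small.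
  case xB : (x \in B); first exact: ltn_trans (idxB _ xB) ltBr.
  by have := idxC x; rewrite inE xB xA => /(_ isT)/andP[].
have A1 : p @: arc (0 + #|B|) = A :\: B :|: D.
  apply: arcP => [|x]; last first.
    move=> xCD; have /andP[le1 le2] : #|B| <= index x s < #|B| + r.
      move: xCD; rewrite inE => /orP[/idxC|/idxD]; move: (index x s) #|B| ltBr => j b ltb;
        by clear -ltb; lia.
    exists (index x s - #|B|); first by rewrite ltn_subLR.
    by rewrite add0n subnKC // modn_small.
  rewrite cardsU disjoint_setI0 ?cards0 ?subn0; first by lia.
  rewrite disjoint_sym disjoints_subset.
  by apply/subsetP => x /DA; rewrite !inE => ->; rewrite andbF.
have A2 : p @: arc (0 + (n - r + #|B|)) = B :|: E.
  apply: arcP => [|x].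
    rewrite cardsU disjoint_setI0 ?cards0 ?subn0; first by lia.
    rewrite disjoints_subset.
    by apply/subsetP => x /BA xA; rewrite !inE; apply/negP => /EA; rewrite xA.
  rewrite inE => /orP[/idxB|/idxE] h.
    exists (index x s + (r - #|B|)); first by lia.
    have -> : 0 + (n - r + #|B|) + (index x s + (r - #|B|)) = n + index x s by lia.
    by rewrite modnDl modn_small.
  exists (index x s - (n - r + #|B|)); first by have := lt_idx x; lia.
  by rewrite add0n subnKC // modn_small.
have F0 : arcs_in_F p 0 by rewrite /arcs_in_F A0.
have [_ /(_ (sum_arcs_eq p) #|B|)] := katona_cycle r_gt0 le2rn (arcs_per p) (@arcs_disj p) F0.
by rewrite B_gt0 ltBr /arcs_in_F A1 A2; apply.
Qed.

End Katona.

Definition star n r (x : 'I_n) : {set {set 'I_n}} := [set e in rsets n r | x \in e].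

Lemma card_star n r (x : 'I_n) : 0 < r -> #|star r x| = 'C(n.-1, r.-1).
Proof.
move=> r_gt0.
pose U : {set 'I_n} := [set~ x].
have cU : #|U| = n.-1 by rewrite cardsC1 card_ord.
have inU (e : {set 'I_n}) : e \subset U -> x \notin e.
  by move=> /subsetP eU; apply/negP => /eU; rewrite !inE eqxx.
rewrite -cU -cards_draws.
rewrite -(card_in_imset (f := fun e : {set 'I_n} => x |: e)); last first.
  move=> e f; rewrite !inE => /andP[/inU xe _] /andP[/inU xf _] eqef.
  by rewrite -(setU1K xe) eqef setU1K.
apply: eq_card => e; apply/idP/imsetP => [|[f + ->]].
  rewrite !inE => /andP[/eqP ce xe]; exists (e :\ x); last by rewrite setD1K.
  rewrite inE; apply/andP; split; first by rewrite /U -setTD setSD ?subsetT.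
  by have := cardsD1 x e; rewrite xe ce => ->.
rewrite !inE eqxx andbT => /andP[/inU xf /eqP cf].
by rewrite cardsU1 xf cf; lia.
Qed.

(** * From the exchange property to a star *)

Section Uniqueness.
Variables (n r : nat) (F : {set {set 'I_n}}).
Hypotheses (r_gt1 : 1 < r) (lt2rn : r.*2 < n).
Hypotheses (sF : F \subset rsets n r) (iF : intersecting F).
Hypothesis cF : #|F| = 'C(n.-1, r.-1).

Let card_F A : A \in F -> #|A| = r.
Proof. by move/(subsetP sF); rewrite inE => /eqP. Qed.

Let cardC A : A \in F -> #|~: A| = n - r.
Proof. by move=> AF; rewrite cardsCs setCK card_ord card_F. Qed.

Let exch := katona_exchange (ltnW r_gt1) (ltnW lt2rn) sF iF cF.

(* [C] is good for [A] when it can be completed outside [A] in every way; by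
   [exchange_indep] one completion in [F] is enough. *)
Let good (A C : {set 'I_n}) :=
  forall D : {set 'I_n}, D \subset ~: A -> #|D| = r - #|C| -> C :|: D \in F.

(** [D] is turned into [D'] one point at a time. The completions before and after a swap are
    compared with a common [E] disjoint from both: each is in [F] exactly when [A :\: C :|: E] is
    not. *)
Let exchange_indep (A C D D' : {set 'I_n}) :
  A \in F -> C \subset A -> 0 < #|C| < r -> D \subset ~: A -> D' \subset ~: A ->
  #|D| = r - #|C| -> #|D'| = r - #|C| -> C :|: D \in F -> C :|: D' \in F.
Proof.
move=> AF sCA cC; have [k] := ubnP #|D' :\: D|.
elim: k D => // k IHk D ltk sD sD' cD cD' CD.
have [/eqP|] := posnP #|D' :\: D|.
  rewrite cards_eq0 setD_eq0 => sDD.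
  suff -> : D' = D by [].
  by apply/eqP; rewrite eqEcard sDD cD cD' leqnn.
rewrite card_gt0 => /set0Pn[y]; rewrite inE => /andP[yD yD'].
have : 0 < #|D :\: D'|.
  have : 0 < #|D' :\: D| by rewrite card_gt0; apply/set0Pn; exists y; rewrite inE yD.
  by rewrite !cardsD setIC cD cD'.
rewrite card_gt0 => /set0Pn[z]; rewrite inE => /andP[zD' zD].
pose D1 := y |: (D :\ z).
have sD1 : D1 \subset ~: A.
  apply/subsetP => u; rewrite !inE => /orP[/eqP->|/andP[_ /(subsetP sD)]]; last by rewrite inE.
  by have := subsetP sD' y yD'; rewrite inE.
have cD1 : #|D1| = r - #|C|.
  rewrite cardsU1 !inE (negbTE yD) andbF /=.
  by have := cardsD1 z D; rewrite zD cD => ->.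
apply: (IHk D1) => //.
  suff lt : #|D' :\: D1| < #|D' :\: D| by apply: leq_trans lt _; rewrite -ltnS.
  apply: proper_card; apply/properP; split.
    apply/subsetP => u; rewrite !inE negb_or negb_and negbK => /andP[/andP[_ /orP[/eqP->|->]] //].
    by rewrite (negbTE zD').
  by exists y; rewrite !inE ?yD ?eqxx.
(* Room for [E] outside [A], [D] and [y] means [#|C| <= n - r - (r - #|C| + 1)], that is,
   [2 r < n]. *)
have [|E sE cE] := @exists_subset_card _ (~: A :\: (y |: D)) #|C|.
  rewrite cardsD (setIidPr _); last first.
    by apply/subsetP => u; rewrite !inE => /orP[/eqP->|/(subsetP sD)]; [have := subsetP sD' y yD'|]; rewrite inE.
  by rewrite cardC // cardsU1 yD cD; move: #|C| cC => c cC; clear -cC lt2rn; lia.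
have sEA : E \subset ~: A by apply: subset_trans sE (subsetDl _ _).
have dE (D2 : {set 'I_n}) : D2 \subset y |: D -> [disjoint D2 & E].
  move=> sD2; rewrite disjoint_sym; apply: disjointWl sE _.
  by rewrite disjoints_subset setDE; apply: subset_trans (subsetIr _ _) _; rewrite setCS.
have cB : #|A :\: C| = r - #|C| by rewrite cardsD (setIidPr sCA) card_F.
have AB : A :\: (A :\: C) = C by rewrite setDDr setDv set0U; apply/setIidPr.
have X (D2 : {set 'I_n}) : D2 \subset y |: D -> D2 \subset ~: A -> #|D2| = r - #|C| ->
    (C :|: D2 \in F) != (A :\: C :|: E \in F).
  move=> sD2 sD2A cD2; rewrite -{1}AB; apply: exch; rewrite ?cB ?subsetDl ?dE //.
    by move: #|C| cC => c cC; clear -cC; lia.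
  by rewrite cE; move: #|C| cC => c cC; clear -cC; lia.
have := X D (subsetUr _ _) sD cD; rewrite CD.
have := X D1 (setUS _ (subD1set _ _)) sD1 cD1.
by case: (C :|: D1 \in F); case: (_ \in F).
Qed.

(** For one choice of disjoint [D] and [E] outside [A] the exchange property puts a completion of
    [B] or of [A :\: B] in [F]; [exchange_indep] extends this to all completions. *)
Let good_or (A B : {set 'I_n}) :
  A \in F -> B \subset A -> 0 < #|B| < r -> good A B \/ good A (A :\: B).
Proof.
move=> AF sBA cB.
have cA := card_F AF.
have cAB : #|A :\: B| = r - #|B| by rewrite cardsD (setIidPr sBA) cA.
have [|D [E [sD sE dDE cD cE]]] := @exists_disjoint_subsets _ (~: A) #|B| (r - #|B|).
  by rewrite cardC //; move: #|B| cB => b cB; clear -cB lt2rn; lia.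
have rb : r - (r - #|B|) = #|B| by move: #|B| cB => b cB; clear -cB; lia.
have := exch AF sBA cB sD sE dDE cD cE.
case h : (B :|: E \in F); first by left=> E' sE' cE'; apply: (exchange_indep AF sBA cB sE).
case h' : (_ \in F) => // _; right=> D' sD' cD'.
apply: (exchange_indep AF (subsetDl _ _) _ sD sD' _ cD' h').
- by rewrite cAB; move: #|B| cB => b cB; clear -cB; lia.
- by rewrite cAB rb.
Qed.

(** Otherwise [good_or] makes [A :\: (c |: C)] good. Completing it by [E] and [C] by [D], with [D]
    and [E] disjoint outside [A], gives two disjoint members of [F]. *)
Let good_setU1 (A C : {set 'I_n}) c :
  A \in F -> C \subset A -> 0 < #|C| -> c \in A -> c \notin C -> #|C|.+1 < r ->
  good A C -> good A (c |: C).
Proof.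
move=> AF sCA C0 cA cC ltCr gC.
have cA' := card_F AF.
have ccC : #|c |: C| = #|C|.+1 by rewrite cardsU1 cC.
have sA : c |: C \subset A by rewrite subUset sub1set cA.
have [|//|gD] := @good_or A (c |: C) AF sA; first by rewrite ccC.
have [|D [E [sD sE dDE cD cE]]] := @exists_disjoint_subsets _ (~: A) (r - #|C|) #|C|.+1.
  by rewrite cardC //; move: #|C| ltCr => b cB; clear -cB lt2rn; lia.
have cAB : #|A :\: (c |: C)| = r - #|C|.+1 by rewrite cardsD (setIidPr sA) cA' ccC.
have FD := gC D sD cD.
have FE := gD E sE; rewrite cAB in FE.
have {}FE : A :\: (c |: C) :|: E \in F.
  by apply: FE; rewrite cE; move: #|C| ltCr => b cB; clear -cB; lia.
have /set0Pn[x] := iF FD FE; rewrite !inE negb_or => /andP[/orP[xC|xD]].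
  rewrite xC andbF /= => xE; have := subsetP sE x xE; rewrite inE.
  by rewrite (subsetP sCA x xC).
have := subsetP sD x xD; rewrite inE => /negbTE->; rewrite andbF /= => xE.
by have := disjointFr dDE xD; rewrite xE.
Qed.

(** Starting from [[set x]], the other elements of [C] are added one by one with [good_setU1];
    properness keeps the sizes below [r]. *)
Let good_sub (A C : {set 'I_n}) x :
  A \in F -> x \in C -> C \proper A -> good A [set x] -> good A C.
Proof.
move=> AF xC pCA gx; have cA := card_F AF.
have sCA := proper_sub pCA; have := proper_card pCA; rewrite cA => ltC.
have [k] := ubnP #|C|; elim: k C xC {pCA} sCA ltC => // k IHk C xC sCA ltC ltk.
have [C1|/set0Pn[c]] := eqVneq (C :\ x) set0; first by rewrite -(setD1K xC) C1 setU0.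
rewrite !inE => /andP[cx cC].
have e := cardsD1 c C; rewrite cC add1n in e.
have xC' : x \in C :\ c by rewrite !inE eq_sym cx.
have sC' : C :\ c \subset A by apply: subset_trans sCA; apply: subD1set.
rewrite -(setD1K cC); apply: good_setU1 => //.
- by apply/card_gt0P; exists x.
- exact: (subsetP sCA).
- by rewrite !inE eqxx.
- by rewrite -e.
- by apply: IHk => //; [apply: ltn_trans ltC; rewrite e|rewrite -ltnS -e].
Qed.

(* Otherwise F is closed under swapping one element, hence consists of all r-sets. *)
Let good_singleton : exists2 A, A \in F & exists2 x, x \in A & good A [set x].
Proof.
have [A0 A0F] : exists A, A \in F.
  by apply/set0Pn; rewrite -card_gt0 cF bin_gt0; clear -lt2rn r_gt1; lia.
have [|S sS cS] := @exists_subset_card _ (~: A0) r.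
  by rewrite cardC //; clear -lt2rn; lia.
have dS : A0 :&: S = set0.
  by apply: disjoint_setI0; rewrite disjoint_sym disjoints_subset.
have [//|nex] := Classical_Prop.classic (exists2 A, A \in F & exists2 x, x \in A & good A [set x]).
(* No singleton is good, so [good_or] makes the rest [A :\ x] good, and [x] may be replaced by any
   point outside [A]. *)
have swap A x y : A \in F -> x \in A -> y \notin A -> y |: (A :\ x) \in F.
  move=> AF xA yA; have cA := card_F AF.
  have [||gx|g] := @good_or A [set x] AF; rewrite ?sub1set ?cards1 //.
    by case: nex; exists A => //; exists x.
  rewrite setUC; apply: g; first by rewrite sub1set inE.
  by rewrite cardsD (setIidPr _) ?sub1set // !cards1 cA; clear -r_gt1; lia.
(* Swaps lead from [A0] to the disjoint set [S], and each of them brings the current set closer to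
   [S]. *)
have SF : S \in F; last by have := iF A0F SF; rewrite dS eqxx.
have [k] := ubnP #|S :\: A0|; elim: k A0 A0F {sS dS} => // k IHk A AF ltk.
have cA := card_F AF.
have [/eqP|] := posnP #|S :\: A|.
  rewrite cards_eq0 setD_eq0 => sSA; suff -> : S = A by [].
  by apply/eqP; rewrite eqEcard sSA cS cA leqnn.
move=> lt0; have : 0 < #|A :\: S| by move: lt0; rewrite !cardsD setIC cA cS.
move: lt0; rewrite !card_gt0 => /set0Pn[y]; rewrite inE => /andP[yA yS].
case/set0Pn=> x; rewrite inE => /andP[xS xA].
apply: (IHk _ (swap _ _ _ AF xA yA)).
suff lt : #|S :\: (y |: A :\ x)| < #|S :\: A| by apply: leq_trans lt _; rewrite -ltnS.
apply: proper_card; apply/properP; split.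
  apply/subsetP => u; rewrite !inE negb_or negb_and negbK => /andP[/andP[_ /orP[/eqP->|->]] //].
  by rewrite (negbTE xS).
by exists y; rewrite !inE ?yA ?eqxx.
Qed.

(** If [S] contains [x] and not all of [A], then [S :&: A] is good by [good_sub] and [S :\: A] is
    one of its completions. So the star lies in [F], and the sizes agree. *)
Lemma ekr_unique_gt1 : exists x, F = star r x.
Proof.
have [A AF [x xA gx]] := good_singleton; exists x.
apply/esym/eqP; rewrite eqEcard card_star ?(ltnW r_gt1) // cF leqnn andbT.
apply/subsetP => S; rewrite !inE => /andP[/eqP cS xS].
have cA := card_F AF.
have [sAS|nsAS] := boolP (A \subset S).
  by suff <- : A = S by []; apply/eqP; rewrite eqEcard sAS cA cS leqnn.
have pSA : S :&: A \proper A.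
  rewrite properE subsetIr /=; apply: contra nsAS => sA.
  exact: subset_trans sA (subsetIl _ _).
rewrite -(setID S A); apply: (good_sub AF _ pSA gx); first by rewrite inE xS.
  by rewrite setDE subsetIr.
by rewrite cardsD cS.
Qed.

End Uniqueness.

Theorem ekr_unique n r (F : {set {set 'I_n}}) :
  0 < r -> r.*2 < n -> F \subset rsets n r -> intersecting F ->
  #|F| = 'C(n.-1, r.-1) -> exists x, F = star r x.
Proof.
case: r => // -[|r] _ lt2rn sF iF cF; last exact: ekr_unique_gt1.
(* For [r = 1] the size is C(n-1, 0) = 1, so [F] consists of one singleton. *)
move: cF; rewrite bin0 => /eqP/cards1P[e eF].
have : e \in rsets n 1 by apply: (subsetP sF); rewrite eF inE.
rewrite inE => /cards1P[x ex]; exists x; rewrite eF ex.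
apply/setP => f; rewrite !inE; apply/eqP/andP => [->|[/cards1P[y ->]]].
  by rewrite cards1 inE.
by rewrite inE => /eqP->.
Qed.

(** * Counting r-sets that meet given sets *)

Lemma leq_card_sum (T I : finType) (H : {set T}) (P : {set I}) (R : I -> {set T}) :
  (forall S, S \in H -> exists2 i, i \in P & S \in R i) ->
  #|H| <= \sum_(i in P) #|R i|.
Proof.
move=> cov; under eq_bigr do rewrite -sum1_card big_mkcond.
rewrite exchange_big /= -sum1_card big_mkcond /=; apply: leq_sum => S _.
case: ifP => // /cov[i iP Si].
by rewrite (bigD1 i) //= Si.
Qed.

Lemma sum_leq_card (T I : finType) (H : {set T}) (P : {set I}) (R : I -> {set T}) :
  (forall i, i \in P -> R i \subset H) ->
  (forall S i j, i \in P -> j \in P -> S \in R i -> S \in R j -> i = j) ->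
  \sum_(i in P) #|R i| <= #|H|.
Proof.
move=> sRH inj; under eq_bigr do rewrite -sum1_card big_mkcond.
rewrite exchange_big /= -[X in _ <= X]sum1_card [X in _ <= X]big_mkcond /=.
apply: leq_sum => S _.
have [/existsP[i /andP[iP Si]]|/existsPn nex] := boolP [exists i, (i \in P) && (S \in R i)].
  rewrite (subsetP (sRH _ iP) _ Si) (bigD1 i) //= Si big1 // => j /andP[jP ji].
  case: ifP => // Sj; by rewrite (inj S j i) ?eqxx in ji.
rewrite big1 // => i iP; case: ifP => // Si.
by have := nex i; rewrite iP Si.
Qed.

(** * Inequalities between binomial coefficients *)

Lemma bin_ge m k : 0 < k < m -> m <= 'C(m, k).
Proof.
elim: m k => // m IHm [//|k] /andP[_ ltkm]; rewrite binS.
case: k ltkm => [|k] ltkm; first by rewrite bin1 bin0 addn1.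
have h1 : m <= 'C(m, k.+1) by apply: IHm; rewrite ltnS in ltkm; rewrite ltkm.
have h2 : 0 < 'C(m, k.+2) by rewrite bin_gt0.
by lia.
Qed.

(** Removing one point from an m-set loses C(m-1, k-1) = (k/m) C(m, k) of its k-subsets, so removing
    [t] points loses at most the fraction tk/m. *)
Lemma bin_leq_sub m t k : t <= m -> m * 'C(m, k) <= m * 'C(m - t, k) + t * k * 'C(m, k).
Proof.
case: k => [|k]; first by rewrite !bin0 muln0 mul0n addn0.
move=> letm.
suff h : 'C(m, k.+1) <= 'C(m - t, k.+1) + t * 'C(m.-1, k).
  have := mul_bin_diag m k; move: h.
  move: 'C(m, _) 'C(m - t, _) 'C(m.-1, _) => x y z; clear.
  by move=> /(leq_mul (leqnn m)); rewrite mulnDr => h e; rewrite -mulnA -e mulnCA.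
elim: t letm => [|t IHt] lttm; first by rewrite subn0 mul0n addn0.
apply: leq_trans (IHt (ltnW lttm)) _.
rewrite -[in X in X <= _](@prednK (m - t)) ?subn_gt0 // binS -subnS mulSn addnA leq_add2r leq_add2l.
by apply: leq_bin2l; lia.
Qed.

Lemma bin_leq_half m t k : (t * k).*2 <= m -> 'C(m, k) <= ('C(m - t, k)).*2.
Proof.
case: k => [|k]; first by rewrite !bin0.
move=> h; have letm : t <= m by nia.
have [->|m0] := posnP m; first by rewrite bin0n.
have h1 := bin_leq_sub k.+1 letm; rewrite -(leq_pmul2l m0).
have := leq_mul h (leqnn 'C(m, k.+1)); move: h1.
by move: 'C(m, _) 'C(m - t, _) (t * k.+1) => x y z; clear; nia.
Qed.

(** Two random r-sets are disjoint with probability at most 1 / (1 + r^2/n). Pascal's rule, applied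
    [r] times, gives C(n, r) >= C(n-r, r) + r C(n-r, r-1), and n C(n-r, r-1) >= r C(n-r, r). *)
Lemma bin_miss n r : r.*2 <= n -> (n + r * r) * 'C(n - r, r) <= n * 'C(n, r).
Proof.
move=> le2rn; case: r le2rn => [|r] le2rn; first by rewrite mul0n addn0 subn0.
have step t : t <= r.+1 -> 'C(n - r.+1, r.+1) + t * 'C(n - r.+1, r) <= 'C(n - r.+1 + t, r.+1).
  elim: t => [|t IHt] ltt; first by rewrite mul0n !addn0.
  rewrite addnS binS mulSn; have := IHt (ltnW ltt).
  have : 'C(n - r.+1, r) <= 'C(n - r.+1 + t, r) by apply: leq_bin2l; lia.
  by lia.
have := step r.+1 (leqnn _); rewrite subnK; last by lia.
have : r.+1 * 'C(n - r.+1, r.+1) <= n * 'C(n - r.+1, r).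
  by rewrite mul_bin_left leq_mul2r; apply/orP; right; lia.
move: 'C(_, _) 'C(_, r) 'C(n, _) => x y z; clear; nia.
Qed.

Lemma bin_drop2 n r : 1 < r -> n.-1 * 'C(n.-2, r.-2) = r.-1 * 'C(n.-1, r.-1).
Proof.
move=> r_gt1; have := mul_bin_diag n.-1 r.-2 => ->.
by rewrite (_ : r.-2.+1 = r.-1) //; clear -r_gt1; lia.
Qed.

(** The source of the error terms r^2/n: the ratio of [r * 'C(n.-2, r.-2)] to ['C(n.-1, r.-1)]
    bounds the chance that a random member of a star meets a given r-set avoiding the centre. *)
Lemma bin_drop2_le n r : 1 < r <= n ->
  r * 'C(n.-2, r.-2) * n <= r * r * 'C(n.-1, r.-1).
Proof.
move=> /andP[r_gt1 lern]; have n1 : 0 < n.-1 by lia.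
rewrite -(leq_pmul2l n1).
have -> : n.-1 * (r * 'C(n.-2, r.-2) * n) = r * n * (n.-1 * 'C(n.-2, r.-2)) by lia.
rewrite bin_drop2 //; move: 'C(_, _) => M.
have -> : r * n * (r.-1 * M) = r * M * (n * r.-1) by lia.
have -> : n.-1 * (r * r * M) = r * M * (n.-1 * r) by lia.
by rewrite leq_mul2l; apply/orP; right; clear -r_gt1 lern; nia.
Qed.

(** * Families of r-sets with prescribed intersections *)

Section Counting.
Variable n : nat.
Implicit Types (S A B U W X : {set 'I_n}).

Lemma card_trace U W X r : X \subset W -> W \subset U -> #|X| <= r ->
  #|[set S : {set 'I_n} | [&& S \subset U, #|S| == r & S :&: W == X]]|
  = 'C(#|U| - #|W|, r - #|X|).
Proof.
move=> sXW sWU leXr.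
have <- : #|U :\: W| = #|U| - #|W| by rewrite cardsD (setIidPr sWU).
rewrite -cards_draws.
have dX S : S \subset U :\: W -> S :&: W = set0.
  rewrite setDE subsetI -disjoints_subset => /andP[_]; exact: disjoint_setI0.
rewrite -[RHS](card_in_imset (f := fun S => X :|: S)); last first.
  move=> S S'; rewrite !inE => /andP[/dX d1 _] /andP[/dX d2 _] e.
  have K (Z : {set 'I_n}) : Z :&: W = set0 -> (X :|: Z) :\: W = Z.
    move=> dZ; apply/setP => x; have /setP/(_ x) := dZ; rewrite !inE.
    have := subsetP sXW x; case: (x \in X) => [/(_ isT)->|_] /=; first by rewrite andbT.
    by case: (x \in W) => //=; case: (x \in Z).
  by rewrite -(K S) // e K.
apply: eq_card => S; apply/idP/imsetP => [|[S' + ->]].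
  rewrite inE => /and3P[sSU /eqP cS /eqP SW].
  exists (S :\: W); last by rewrite -SW setID.
  rewrite inE setSD //=; apply/eqP.
  by have := cardsID W S; rewrite SW cS => <-; rewrite addKn.
rewrite !inE => /andP[sS /eqP cS]; have d := dX _ sS; apply/and3P; split.
- rewrite subUset (subset_trans sXW sWU); exact: subset_trans sS (subsetDl _ _).
- rewrite cardsU cS; suff -> : X :&: S' = set0 by rewrite cards0 subn0 subnKC.
  by apply/eqP; rewrite -subset0 -d setIC setIS.
- by rewrite setIUl d setU0; apply/eqP/setIidPl.
Qed.

Lemma card_supersets U X r : X \subset U -> #|X| <= r ->
  #|[set S : {set 'I_n} | [&& S \subset U, #|S| == r & X \subset S]]|
  = 'C(#|U| - #|X|, r - #|X|).
Proof.
move=> sXU leXr; rewrite -(card_trace (subxx _) sXU leXr); apply: eq_card => S.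
by rewrite !inE; congr [&& _, _ & _]; apply/setIidPr/eqP.
Qed.

Lemma card_rsets r : #|rsets n r| = 'C(n, r).
Proof. by rewrite /rsets card_draws card_ord. Qed.

Definition hits r U A : {set {set 'I_n}} :=
  [set S : {set 'I_n} | [&& S \subset U, #|S| == r & S :&: A != set0]].

Definition hits2 r U A B : {set {set 'I_n}} :=
  [set S : {set 'I_n} | [&& S \subset U, #|S| == r, S :&: A != set0 & S :&: B != set0]].

(** Only sets meeting [A] in exactly one point are counted, so the classes indexed by that point are
    disjoint. *)
Lemma card_hits_ge r U A : 0 < r -> A \subset U ->
  #|A| * 'C(#|U| - #|A|, r.-1) <= #|hits r U A|.
Proof.
move=> r_gt0 sAU.
pose R (a : 'I_n) := [set S : {set 'I_n} | [&& S \subset U, #|S| == r & S :&: A == [set a]]].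
rewrite -sum_nat_const (eq_bigr (fun a => #|R a|)) => [|a aA].
  apply: sum_leq_card => [a aA|S a b aA bA].
    apply/subsetP => S; rewrite !inE => /and3P[-> -> /eqP->] /=.
    by apply/set0Pn; exists a; rewrite inE.
  by rewrite !inE => /and3P[_ _ /eqP->] /and3P[_ _ /eqP/set1_inj].
by rewrite card_trace ?cards1 ?subn1 ?sub1set.
Qed.

(** Counts the sets whose trace on [A :|: B] is one point of each; the trace determines the pair. *)
Lemma card_hits2_ge r U A B : 1 < r -> A \subset U -> B \subset U -> [disjoint A & B] ->
  #|A| * #|B| * 'C(#|U| - (#|A| + #|B|), r.-2) <= #|hits2 r U A B|.
Proof.
move=> r_gt1 sAU sBU dAB.
pose R (p : 'I_n * 'I_n) :=
  [set S : {set 'I_n} | [&& S \subset U, #|S| == r & S :&: (A :|: B) == [set p.1; p.2]]].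
have cAB : #|A :|: B| = #|A| + #|B| by rewrite cardsU disjoint_setI0 // cards0 subn0.
rewrite -cardsX -sum_nat_const (eq_bigr (fun p => #|R p|)) => [|[a b]].
  have tr S a b : a \in A -> b \in B -> S \in R (a, b) -> S :&: A = [set a] /\ S :&: B = [set b].
    move=> aA bB; rewrite !inE /= => /and3P[_ _ /eqP e].
    have aB := disjointFr dAB aA; have bA := disjointFl dAB bB.
    have h x : (x \in S) && ((x \in A) || (x \in B)) = (x == a) || (x == b).
      by have /setP/(_ x) := e; rewrite !inE.
    split; apply/setP => x; rewrite !inE; have := h x.
      case xA : (x \in A).
        by rewrite orTb => ->; case: (x =P b) => [xb|]; rewrite ?orbF //; rewrite xb bA in xA.
      by rewrite andbF => _; apply/esym; apply: contraFF xA => /eqP->.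
    case xB : (x \in B).
      by rewrite orbT => ->; case: (x =P a) => [xa|//]; rewrite xa aB in xB.
    by rewrite andbF => _; apply/esym; apply: contraFF xB => /eqP->.
  apply: sum_leq_card => [[a b]|S [a b] [a' b']]; rewrite !in_setX /= => /andP[aA bB].
    apply/subsetP => S SR; have [e1 e2] := tr S a b aA bB SR.
    move: SR; rewrite !inE e1 e2 => /and3P[-> -> _] /=.
    by apply/andP; split; apply/set0Pn; [exists a | exists b]; rewrite inE.
  move=> /andP[aA' bB'] S1 S2.
  have [e1 e2] := tr S a b aA bB S1; have [f1 f2] := tr S a' b' aA' bB' S2.
  by congr (_, _); apply: set1_inj; [rewrite -e1 | rewrite -e2].
rewrite !inE /= => /andP[aA bB].
have ab : a != b by apply: contraTneq bB => <-; rewrite (disjointFr dAB aA).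
rewrite card_trace ?cards2 ?ab ?cAB ?subn2 //; last by rewrite subUset sAU sBU.
by apply/subsetP => x; rewrite !inE => /orP[/eqP->|/eqP->]; rewrite ?aA ?bB ?orbT.
Qed.

(** Union bound over the pairs of points, one from each set, contained in [S]. *)
Lemma card_hits2_le r U A B : 1 < r -> A \subset U -> B \subset U -> [disjoint A & B] ->
  #|hits2 r U A B| <= #|A| * #|B| * 'C(#|U|.-2, r.-2).
Proof.
move=> r_gt1 sAU sBU dAB.
pose R (p : 'I_n * 'I_n) :=
  [set S : {set 'I_n} | [&& S \subset U, #|S| == r & [set p.1; p.2] \subset S]].
rewrite -cardsX -sum_nat_const (eq_bigr (fun p => #|R p|)) => [|[a b]].
  apply: leq_card_sum => S; rewrite !inE => /and4P[sSU cS /set0Pn[a]].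
  rewrite inE => /andP[aS aA] /set0Pn[b]; rewrite inE => /andP[bS bB].
  by exists (a, b); rewrite !inE ?aA ?bB // sSU cS subUset !sub1set aS bS.
rewrite !inE /= => /andP[aA bB].
have ab : a != b by apply: contraTneq bB => <-; rewrite (disjointFr dAB aA).
rewrite card_supersets ?cards2 ?ab ?subn2 //.
by rewrite subUset !sub1set (subsetP sAU) // (subsetP sBU).
Qed.

Lemma card_star_hits_le r x A : 1 < r -> x \notin A ->
  #|[set S in star r x | S :&: A != set0]| <= #|A| * 'C(n.-2, r.-2).
Proof.
move=> r_gt1 xA.
pose R (a : 'I_n) := [set S : {set 'I_n} | [&& S \subset setT, #|S| == r & [set x; a] \subset S]].
rewrite -sum_nat_const (eq_bigr (fun p => #|R p|)) => [|a aA].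
  apply: leq_card_sum => S; rewrite !inE => /andP[/andP[cS xS] /set0Pn[a]].
  rewrite inE => /andP[aS aA].
  by exists a => //; rewrite !inE subsetT cS subUset !sub1set xS aS.
have ab : x != a by apply: contraNneq xA => ->.
by rewrite card_supersets ?subsetT ?cards2 ?ab ?subn2 // cardsT card_ord.
Qed.

Lemma card_meet2_le r A : 1 < r ->
  #|[set S in rsets n r | 1 < #|S :&: A|]| <= #|A| * #|A| * 'C(n.-2, r.-2).
Proof.
move=> r_gt1.
pose R (p : 'I_n * 'I_n) :=
  [set S : {set 'I_n} | [&& S \subset setT, #|S| == r & [set p.1; p.2] \subset S]].
pose P := [set p in setX A A | p.1 != p.2].
apply: (@leq_trans (\sum_(p in P) #|R p|)).
  apply: leq_card_sum => S; rewrite !inE => /andP[cS /card_gt1P[a [b [aSA bSA ab]]]].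
  move: aSA bSA; rewrite !inE => /andP[aS aA] /andP[bS bA].
  by exists (a, b); rewrite !inE /= ?aA ?bA ?ab // cS subsetT subUset !sub1set aS bS.
rewrite (eq_bigr (fun=> 'C(n.-2, r.-2))) => [|[a b]].
  rewrite sum_nat_const leq_mul2r -cardsX; apply/orP; right; apply: subset_leq_card.
  by apply/subsetP => p; rewrite inE => /andP[].
rewrite !inE /= => /andP[_ ab].
by rewrite card_supersets ?cards2 ?ab ?subn2 ?subsetT // cardsT card_ord.
Qed.

Lemma card_miss r A : #|[set S in rsets n r | S :&: A == set0]| = 'C(n - #|A|, r).
Proof.
have := @card_trace setT A set0 r (sub0set _) (subsetT _).
rewrite cards0 cardsT card_ord subn0 => <- //; apply: eq_card => S.
by rewrite !inE subsetT.
Qed.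

End Counting.

Local Open Scope ring_scope.

(** * Upper bounds from the size of the common intersection *)

Section Average.
Variables (T : finType) (A : {set T}) (f : T -> rat).
Hypothesis A0 : A != set0.

Let card0 : 0 < #|A|%:R :> rat.
Proof. by rewrite ltr0n card_gt0. Qed.

Lemma average_le b : (forall e, e \in A -> f e <= b) ->
  #|A|%:R^-1 * \sum_(e in A) f e <= b.
Proof.
move=> le; rewrite ler_pdivrMl // mulrC mulr_natr -sumr_const; exact: ler_sum.
Qed.

Lemma average_ge b : (forall e, e \in A -> b <= f e) ->
  b <= #|A|%:R^-1 * \sum_(e in A) f e.
Proof.
move=> le; rewrite ler_pdivlMl // mulrC mulr_natr -sumr_const; exact: ler_sum.
Qed.

End Average.

(** [D] holds the exceptional choices, for which only the trivial bound 1 is available. *)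
Lemma average_close (T : finType) (A D : {set T}) (f : T -> rat) (v d : rat) :
  A != set0 -> 0 <= d ->
  (forall e, e \in A -> e \in D -> `|f e - v| <= 1) ->
  (forall e, e \in A -> e \notin D -> `|f e - v| <= d) ->
  `|#|A|%:R^-1 * (\sum_(e in A) f e) - v| <= d + #|D|%:R / #|A|%:R.
Proof.
move=> A0 d0 hD hA.
have c0 : 0 < #|A|%:R :> rat by rewrite ltr0n card_gt0.
have -> : #|A|%:R^-1 * (\sum_(e in A) f e) - v = #|A|%:R^-1 * \sum_(e in A) (f e - v).
  by rewrite sumrB sumr_const -mulr_natr; field; rewrite gt_eqF.
rewrite normrM gtr0_norm ?invr_gt0 // ler_pdivrMl //.
apply: le_trans (ler_norm_sum _ _ _) _.
have -> : #|A|%:R * (d + #|D|%:R / #|A|%:R) = \sum_(e in A) d + \sum_(e in D) 1.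
  by rewrite !sumr_const -mulr_natr; field; rewrite gt_eqF.
rewrite big_mkcond /= [X in _ <= X + _]big_mkcond [X in _ <= _ + X]big_mkcond -big_split /=.
apply: ler_sum => e _; case eA : (e \in A); case: ifPn => eD; rewrite ?addr0 //.
- by apply: le_trans (hD e eA eD) _; rewrite lerDr.
- exact: hA.
Qed.

Section Process.
Variables n r : nat.
Hypotheses (r_gt0 : (0 < r)%N).
Notation N := 'C(n.-1, r.-1).
Notation pstar := (@pstar_from n r).
Implicit Types (F : {set {set 'I_n}}) (e f : {set 'I_n}).

Definition valid F := F \subset rsets n r /\ intersecting F.

Lemma in_avail F e : e \in avail r F ->
  [/\ #|e| = r, e \notin F & forall f, f \in F -> e :&: f != set0].
Proof. by rewrite !inE => /andP[/eqP ce /andP[eF /forall_inP h]]. Qed.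

Lemma valid0 : valid set0.
Proof. by split=> [|e f]; rewrite ?sub0set ?inE. Qed.

Lemma valid_setU1 F e : valid F -> e \in avail r F -> valid (e |: F).
Proof.
move=> [sF iF] /in_avail[ce eF he]; split=> [|f g].
  by rewrite subUset sF sub1set inE ce eqxx.
rewrite !inE => /orP[/eqP->|fF] /orP[/eqP->|gF]; last exact: iF.
- by rewrite setIid -card_gt0 ce.
- exact: he.
- by rewrite setIC he.
Qed.

Lemma card_setU1_avail F e : e \in avail r F -> #|e |: F| = #|F|.+1.
Proof. by move=> /in_avail[_ eF _]; rewrite cardsU1 eF. Qed.

Lemma pstar_step k F : avail r F != set0 ->
  pstar k.+1 F = #|avail r F|%:R^-1 * \sum_(e in avail r F) pstar k (e |: F).
Proof. by move=> /negbTE /= ->. Qed.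

Lemma pstar_ge0 k F : 0 <= pstar k F.
Proof.
elim: k F => //= k IHk F; case: eqP => [_|/eqP A0]; first exact: ler0n.
by apply: average_ge.
Qed.

Lemma pstar_le1 k F : pstar k F <= 1.
Proof.
elim: k F => //= k IHk F; case: eqP => [_|/eqP A0]; first by rewrite lern1 leq_b1.
by apply: average_le.
Qed.

(** For the empty family this is all of [n], so the size of the intersection starts at [n]. *)
Definition common F : {set 'I_n} := [set x | [forall f in F, x \in f]].

Lemma common0 : common set0 = setT.
Proof. by apply/setP => x; rewrite !inE; apply/forall_inP => f; rewrite inE. Qed.

Lemma common_setU1 F e : common (e |: F) = common F :&: e.
Proof.
apply/setP => x; rewrite !inE; apply/forall_inP/andP => [h|[/forall_inP h xe] f].
  split; last by apply: h; rewrite !inE eqxx.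
  by apply/forall_inP => f fF; apply: h; rewrite !inE fF orbT.
by rewrite !inE => /orP[/eqP->|/h].
Qed.

(** An empty common intersection stays empty, whereas by [ekr_unique] a final family of the target
    size has a common point. *)
Lemma pstar_common0 k F : (r.*2 < n)%N -> valid F -> common F = set0 -> pstar k F = 0.
Proof.
move=> lt2rn; elim: k F => //= k IHk F vF cF0.
case: eqP => [_|/eqP A0]; last first.
  rewrite big1 ?mulr0 // => e eA; apply: IHk; first exact: valid_setU1.
  by rewrite common_setU1 cF0 set0I.
case: eqP => // cF; have [sF iF] := vF.
have [x Fx] := ekr_unique r_gt0 lt2rn sF iF cF.
suff : x \in common F by rewrite cF0 inE.
by rewrite inE; apply/forall_inP => f; rewrite Fx inE => /andP[].
Qed.

(** Double counting: a point of [C] lies in at most [N] available sets. *)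
Lemma sum_card_setI_le F (C : {set 'I_n}) :
  (\sum_(e in avail r F) #|C :&: e| <= #|C| * N)%N.
Proof.
rewrite -sum_nat_const; under eq_bigr => e _ do rewrite -sum1_card big_mkcond /=.
rewrite exchange_big /= [X in (_ <= X)%N]big_mkcond /=; apply: leq_sum => x _.
under eq_bigr => e _ do rewrite inE.
case: (x \in C) => /=; last by rewrite big1.
rewrite -(card_star x r_gt0) -big_mkcondr sum1dep_card.
by apply: subset_leq_card; apply/subsetP => e; rewrite !inE => /andP[/andP[->]].
Qed.

(* The expected size of the intersection of the first m sets bounds the
   probability that the final family is a star. *)
Lemma pstar_le_prod (b : nat -> rat) m k F :
  (r.*2 < n)%N -> (forall j, (j < m)%N -> 0 < b j) ->
  (forall F', valid F' -> (#|F'| < m)%N -> b #|F'| <= #|avail r F'|%:R) ->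
  valid F -> (#|F| <= m)%N ->
  pstar k F <= #|common F|%:R * \prod_(#|F| <= j < m) (N%:R / b j).
Proof.
move=> lt2rn b0 hb; move: {2}(m - #|F|)%N (erefl (m - #|F|)%N) => d.
elim: d k F => [|d IHd] k F ed vF lem.
  (* After [m] sets, success requires a common point, and then the intersection has size at least
     1. *)
  rewrite big_geq ?mulr1; last by rewrite -subn_eq0 ed.
  have [c0|/set0Pn[x xc]] := eqVneq (common F) set0; first by rewrite pstar_common0.
  apply: le_trans (pstar_le1 _ _) _; rewrite ler1n card_gt0; apply/set0Pn; by exists x.
have ltm : (#|F| < m)%N by rewrite -subn_gt0 ed.
have ble := hb F vF ltm; have bF0 := b0 _ ltm.
have A0' : 0 < #|avail r F|%:R :> rat by apply: lt_le_trans ble.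
have A0 : avail r F != set0 by rewrite -card_gt0 -(ltr0n rat).
have prod0 i : 0 <= \prod_(i <= j < m) (N%:R / b j) :> rat.
  rewrite big_seq_cond; apply: prodr_ge0 => j /andP[+ _].
  by rewrite mem_index_iota => /andP[_ /b0 bj]; rewrite divr_ge0 // ltW.
case: k => [|k]; first by rewrite mulr_ge0.
rewrite pstar_step // big_ltn //.
set Q := \prod_(_ <= j < m) _.
have Q0 : 0 <= Q by apply: prod0.
(* The expected size of the next intersection is at most [#|common F| * N / #|avail r F|]. *)
apply: (@le_trans _ _ (#|avail r F|%:R^-1 * ((#|common F| * N)%:R * Q))).
  rewrite ler_pM2l ?invr_gt0 //.
  apply: le_trans (_ : (\sum_(e in avail r F) #|common F :&: e|)%:R * Q <= _).
    rewrite natr_sum mulr_suml; apply: ler_sum => e eA.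
    have ce := card_setU1_avail eA.
    have := IHd k (e |: F); rewrite common_setU1 ce; apply; rewrite ?subnS ?ed //.
    exact: valid_setU1.
  by rewrite ler_wpM2r // ler_nat sum_card_setI_le.
have -> : #|common F|%:R * (N%:R / b #|F| * Q) = (b #|F|)^-1 * ((#|common F| * N)%:R * Q).
  by rewrite natrM; ring.
by rewrite ler_wpM2r ?mulr_ge0 // lef_pV2 ?posrE.
Qed.

Lemma card_avail_ge F (H : {set {set 'I_n}}) : H \subset rsets n r ->
  (forall e f, e \in H -> f \in F -> e :&: f != set0) -> (#|H| <= #|avail r F| + #|F|)%N.
Proof.
move=> sH hH; apply: (@leq_trans #|avail r F :|: F|); last by rewrite cardsU leq_subr.
apply: subset_leq_card; apply/subsetP => e eH; rewrite !inE.
case eF : (e \in F); first by rewrite orbT.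
have := subsetP sH e eH; rewrite inE => -> /=; rewrite orbF.
by apply/forall_inP => f; apply: hH.
Qed.

(** Only sets hitting a chosen [a]-subset of the single member are counted. A small [a] keeps the
    loss in [bin_leq_half] below one half even when r^2 exceeds n. *)
Lemma card_avail1_ge a F : valid F -> #|F| = 1%N -> (0 < a <= r)%N ->
  ((a.-1 * r.-1).*2 <= n.-1)%N -> (a * N <= (#|avail r F| + 1).*2)%N.
Proof.
move=> [sF _] cF /andP[a_gt0 lear] small.
have /cards1P[e eF] : #|F| == 1%N by rewrite cF.
have ce : #|e| = r by apply/eqP; have := subsetP sF e; rewrite eF !inE eqxx; apply.
have [|A sA cA] := @exists_subset_card _ e a; first by rewrite ce.
have H1 : (#|hits r setT A| <= #|avail r F| + 1)%N.
  rewrite -cF; apply: card_avail_ge; first by apply/subsetP => S; rewrite !inE => /and3P[].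
  move=> S f; rewrite !inE eF => /and3P[_ _ /set0Pn[x]]; rewrite !inE => /andP[xS xA] /eqP->.
  by apply/set0Pn; exists x; rewrite inE xS (subsetP sA).
have := @card_hits_ge n r setT A r_gt0 (subsetT _); rewrite cA cardsT card_ord => H2.
have := bin_leq_half small.
have -> : (n.-1 - a.-1 = n - a)%N by clear -a_gt0; lia.
move=> H3; rewrite -leq_double in H1; apply: leq_trans H1.
by apply: leq_trans (leq_mul (leqnn a) H3) _; rewrite -doubleMr leq_double.
Qed.

(** As for one set, with disjoint [a]-subsets [A] of [e] and [B] of [e' :\: A]; the latter has at
    least [r - a >= a] points. *)
Lemma card_avail2_ge a F : valid F -> #|F| = 2%N -> (1 < r)%N -> (0 < a)%N -> (a.*2 <= r)%N ->
  ((a.*2.-2 * r.-2).*2 <= n.-2)%N -> (a * a * 'C(n.-2, r.-2) <= (#|avail r F| + 2).*2)%N.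
Proof.
move=> [sF _] cF r_gt1 a_gt0 lear small.
have /cards2P[e [e' [ee' eF]]] : #|F| == 2%N by rewrite cF.
have cFr f : f \in F -> #|f| = r by move=> /(subsetP sF); rewrite inE => /eqP.
have ce : #|e| = r by apply: cFr; rewrite eF !inE eqxx.
have ce' : #|e'| = r by apply: cFr; rewrite eF !inE eqxx orbT.
have [|A sA cA] := @exists_subset_card _ e a; first by rewrite ce; clear -lear; lia.
have [|B sB cB] := @exists_subset_card _ (e' :\: A) a.
  have : (#|e' :&: A| <= a)%N by rewrite -cA subset_leq_card // subsetIr.
  by rewrite cardsD ce'; move: #|_| => z; clear -lear; lia.
have dAB : [disjoint A & B].
  by rewrite disjoint_sym; apply: disjointWl sB _; rewrite disjoints_subset setDE subsetIr.
have sB' := subset_trans sB (subsetDl _ _).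
have H1 : (#|hits2 r setT A B| <= #|avail r F| + 2)%N.
  rewrite -cF; apply: card_avail_ge; first by apply/subsetP => S; rewrite !inE => /and4P[].
  move=> S f; rewrite inE eF => /and4P[_ _ /set0Pn[x +] /set0Pn[y]].
  rewrite !inE => /andP[xS xA] /andP[yS yB] /orP[] /eqP->; apply/set0Pn.
    by exists x; rewrite inE xS (subsetP sA).
  by exists y; rewrite inE yS (subsetP sB').
have := @card_hits2_ge n r setT A B r_gt1 (subsetT _) (subsetT _) dAB.
rewrite cA cB cardsT card_ord => H2.
have := bin_leq_half small.
have -> : (n.-2 - a.*2.-2 = n - (a + a))%N by clear -a_gt0; lia.
move=> H3; rewrite -leq_double in H1; apply: leq_trans H1.
by apply: leq_trans (leq_mul (leqnn (a * a)) H3) _; rewrite -doubleMr leq_double.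
Qed.

(** An r-set neither available nor in [F] misses some member of [F]. The doubling absorbs the
    members of [F] themselves, since C(n-r, r) >= 1. *)
Lemma card_avail_ge_bin F : (r.*2 <= n)%N -> valid F ->
  ('C(n, r) <= #|avail r F| + (#|F| * 'C(n - r, r)).*2)%N.
Proof.
move=> le2rn [sF _].
pose M f := [set S in rsets n r | S :&: f == set0].
have hM : (\sum_(f in F) #|M f| = #|F| * 'C(n - r, r))%N.
  rewrite -sum_nat_const; apply: eq_bigr => f fF; rewrite /M card_miss.
  by have := subsetP sF f fF; rewrite inE => /eqP->.
have h1 : (#|rsets n r :\: (avail r F :|: F)| <= \sum_(f in F) #|M f|)%N.
  apply: leq_card_sum => S; rewrite !inE negb_or => /andP[/andP[nA SF] cS].
  move: nA; rewrite cS SF /= negb_forall_in => /exists_inP[f fF].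
  by rewrite negbK => Sf; exists f => //; rewrite !inE cS.
have h2 : (#|F| <= #|F| * 'C(n - r, r))%N.
  by rewrite leq_pmulr // bin_gt0; clear -le2rn; lia.
rewrite hM cardsD card_rsets in h1.
have h3 : (#|rsets n r :&: (avail r F :|: F)| <= #|avail r F| + #|F|)%N.
  apply: leq_trans (_ : (#|avail r F :|: F| <= _)%N); first exact/subset_leq_card/subsetIr.
  by rewrite cardsU leq_subr.
move: h1 h2 h3; move: #|rsets _ _ :&: _| #|avail r F| #|F| 'C(n, r) ('C(n - r, r)) => x y z t u.
by clear; move: (z * u)%N => w; lia.
Qed.

Lemma bin_ratio : (r <= n)%N -> (N%:R / 'C(n, r)%:R = r%:R / n%:R :> rat).
Proof.
move=> lern; have n_gt0 : (0 < n)%N by apply: leq_trans lern.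
have C0 : 'C(n, r)%:R != 0 :> rat by rewrite pnatr_eq0 -lt0n bin_gt0.
have n0 : n%:R != 0 :> rat by rewrite pnatr_eq0 -lt0n.
apply/eqP; rewrite eqr_div // -!natrM eqr_nat; apply/eqP.
by have := mul_bin_diag n r.-1; rewrite prednK // mulnC.
Qed.

(** During the first [6 q] steps at least two thirds of all r-sets are available, so each factor in
    [pstar_le_prod] is at most [3 / 2 * (r / n) <= 3 / 4]. *)
Lemma prob_star_le_geometric q : (r.*2 < n)%N -> (36 * q * n <= r * r)%N ->
  prob_star_rat n r <= n%:R * (3%:R / 4%:R) ^+ (6 * q).
Proof.
move=> lt2rn hq.
have n_gt0 : (0 < n)%N by clear -lt2rn; lia.
have C0 : 0 < 'C(n, r)%:R :> rat by rewrite ltr0n bin_gt0; clear -lt2rn; lia.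
have := @pstar_le_prod (fun=> 2%:R / 3%:R * 'C(n, r)%:R) (6 * q) 'C(n, r).+1 set0 lt2rn.
rewrite cards0 common0 cardsT card_ord => /(_ _ _ valid0 isT) h.
apply: le_trans (h _ _) _ => [j _|F vF ltF|].
- by rewrite mulr_gt0 // divr_gt0 // ltr0n.
- have le2rn := ltnW lt2rn; have := card_avail_ge_bin le2rn vF; have := bin_miss le2rn.
  move: #|avail r F| #|F| ltF C0 => y z ltF C0.
  move: 'C(n, r) 'C(n - r, r) C0 => C C' C0 h1 h2.
  (* With [#|F| < 6 q] the loss [2 * #|F| * C'] is at most [12 q C' <= C / 3]. *)
  have h3 : (36 * q * C' <= C)%N by rewrite -(leq_pmul2l n_gt0); clear -h1 hq; nia.
  have h4 : (2 * C <= 3 * y)%N by clear -h2 h3 ltF; nia.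
  by move: h4; rewrite -(ler_nat rat) !natrM; lra.
rewrite ler_wpM2l // prodr_const_nat subn0; apply: lerXn2r; rewrite ?nnegrE ?divr_ge0 //.
  by rewrite mulr_ge0 // divr_ge0.
have -> : N%:R / (2%:R / 3%:R * 'C(n, r)%:R) = 3%:R / 2%:R * (N%:R / 'C(n, r)%:R) :> rat.
  by field; rewrite gt_eqF.
rewrite bin_ratio; last by clear -lt2rn; lia.
have : r%:R / n%:R <= 1 / 2 :> rat; last by lra.
rewrite ler_pdivrMr ?ltr0n //; have : (2 * r <= n)%N by clear -lt2rn; lia.
by rewrite -(ler_nat rat) natrM; lra.
Qed.

(** Three factors of [pstar_le_prod] give n (r/n) (4/a) (4N / (a^2 L)), where N/L = (n-1)/(r-1) and
    r/(r-1) <= 2. *)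
Lemma prob_star_le_cube a : (r.*2 < n)%N -> (2 < a)%N -> (a.*2 <= r)%N -> (4 * a * r <= n)%N ->
  prob_star_rat n r <= 32%:R * n%:R / a%:R ^+ 3.
Proof.
move=> lt2rn a_gt2 lear lean.
have n_gt0 : (0 < n)%N by clear -lt2rn; lia.
have r_gt1 : (1 < r)%N by clear -a_gt2 lear; lia.
have C0 : 0 < 'C(n, r)%:R :> rat by rewrite ltr0n bin_gt0; clear -lt2rn; lia.
set L := 'C(n.-2, r.-2).
have NL : (n.-1 * L = r.-1 * N)%N by apply: bin_drop2.
have L0 : (0 < L)%N by rewrite bin_gt0; clear -lt2rn; lia.
have N2 : (2 <= N)%N.
  by apply: leq_trans (bin_ge (_ : 0 < r.-1 < n.-1)%N); clear -lt2rn r_gt1 a_gt2 lear; lia.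
have a0 : 0 < a%:R :> rat by rewrite ltr0n; clear -a_gt2; lia.
have LR : 0 < L%:R :> rat by rewrite ltr0n.
(* Lower bounds for the number of choices in the first three steps; the denominator 4 instead of 2
   pays for the sets already chosen. *)
pose b j : rat := if j is 0 then 'C(n, r)%:R
                  else if j is 1 then a%:R * N%:R / 4%:R else a%:R ^+ 2 * L%:R / 4%:R.
have := @pstar_le_prod b 3 'C(n, r).+1 set0 lt2rn.
rewrite cards0 common0 cardsT card_ord => /(_ _ _ valid0 isT) h.
apply: le_trans (h _ _) _ => [[|[|j]] _ //=|F vF ltF|].
- by rewrite divr_gt0 // mulr_gt0 // ltr0n; clear -N2; lia.
- by rewrite divr_gt0 // mulr_gt0 // exprn_gt0.
- case cF : #|F| ltF => [|[|[|//]]] _ /=.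
  + have -> : F = set0 by apply/eqP; rewrite -cards_eq0 cF.
    rewrite ler_nat -card_rsets; apply: subset_leq_card; apply/subsetP => e eR.
    by rewrite inE eR inE; apply/forall_inP => f; rewrite inE.
  + have := @card_avail1_ge a F vF cF.
    move: #|avail r F| N N2 => y N' N2 h1.
    have {}h1 : (a * N' <= (y + 1).*2)%N by apply: h1; clear -a_gt2 lear lean; nia.
    have h2 : (a * N' <= 4 * y)%N by clear -h1 N2 a_gt2; nia.
    by move: h2; rewrite -(ler_nat rat) !natrM; lra.
  + have := @card_avail2_ge a F vF cF r_gt1; rewrite -/L.
    move: #|avail r F| (L) L0 => y L' L0' h1.
    have {}h1 : (a * a * L' <= (y + 2).*2)%N by apply: h1 => //; clear -a_gt2 lear lean; nia.
    have h2 : (a * a * L' <= 4 * y)%N.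
      have : (9 <= a * a * L')%N by clear -L0' a_gt2; nia.
      by clear -h1; lia.
    by move: h2; rewrite -(ler_nat rat) !natrM; rewrite expr2; lra.
rewrite /index_iota /= !big_cons big_nil /= mulr1.
rewrite (bin_ratio (_ : r <= n)%N); last by clear -lt2rn; lia.
have r1 : 0 < r.-1%:R :> rat by rewrite ltr0n; clear -r_gt1; lia.
have NLR : N%:R = n.-1%:R * L%:R / r.-1%:R :> rat.
  by apply: (canRL (mulfK (lt0r_neq0 r1))); rewrite -!natrM NL mulnC.
have N0 : 0 < N%:R :> rat by rewrite ltr0n; clear -N2; lia.
have nR : 0 < n%:R :> rat by rewrite ltr0n.
have -> : n%:R * (r%:R / n%:R * (N%:R / (a%:R * N%:R / 4%:R) * (N%:R / (a%:R ^+ 2 * L%:R / 4%:R))))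
        = (16%:R * (r%:R * n.-1%:R / r.-1%:R)) / a%:R ^+ 3 :> rat.
  rewrite NLR; field.
  by rewrite !pnatr_eq0 -!lt0n n_gt0 L0 -(ltr0n rat) a0 /=; clear -r_gt1 a_gt2 lean n_gt0; lia.
apply: ler_wpM2r; first by rewrite invr_ge0 exprn_ge0 // ltW.
have : r%:R * n.-1%:R / r.-1%:R <= 2%:R * n%:R :> rat.
  by rewrite ler_pdivrMr // -!natrM ler_nat; clear -r_gt1; nia.
by move: (_ / _) => z; lra.
Qed.
End Process.

(** * The process inside a star *)

(** The induction step of [fail_le_bad]: [K] star members are left, [B] sets are bad, [R] stands for
    [r * L] and [P] for the success probability. Half of [4 / N] pays for a bad choice now; the
    other half and [u] pay for later ones, as [R <= K / 2]. *)
Lemma fail_arith (A : realFieldType) (N K B R P u : A) :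
  0 <= B -> 0 <= u -> N <= 2 * K -> 0 < N -> 4 * R <= N ->
  K - (4 / N + 2 * u) * B * R <= (K + B) * P -> 1 - P <= (4 / N + u) * B.
Proof.
move=> B0 u0 hK N0 hR.
have v0 : 0 <= 4 / N by rewrite divr_ge0 // ltW.
have iN : N * (4 / N) = 4 by rewrite mulrC divfK // gt_eqF.
move: (4 / N) v0 iN => v v0 iN hP.
have h1 : 2 <= K * v by have := ler_wpM2r v0 hK; lra.
have h2 : R * (v * B) <= K / 2 * (v * B) by rewrite ler_wpM2r ?mulr_ge0 //; lra.
have h3 : R * (u * B) <= K / 2 * (u * B) by rewrite ler_wpM2r ?mulr_ge0 //; lra.
have h4 : B * 2 <= B * (K * v) by rewrite ler_wpM2l.
have KB : 0 < K + B by lra.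
rewrite -(ler_pM2l KB); have : 0 <= B * ((v + u) * B) by rewrite !mulr_ge0 // addr_ge0.
by lra.
Qed.

Section StarPhase.
Variables n r : nat.
Hypotheses (r_gt0 : (0 < r)%N).
Notation N := 'C(n.-1, r.-1).
Notation L := 'C(n.-2, r.-2).
Notation pstar := (@pstar_from n r).
Implicit Types (F : {set {set 'I_n}}) (e f : {set 'I_n}).

(** For [F] inside the star of [x] these are the available sets that leave the star. *)
Definition bad (x : 'I_n) F : {set {set 'I_n}} :=
  [set e in rsets n r | (x \notin e) && [forall f in F, e :&: f != set0]].

Lemma avail_star x F : F \subset star r x -> avail r F = (star r x :\: F) :|: bad x F.
Proof.
move=> sF; have xF f : f \in F -> x \in f by move=> /(subsetP sF); rewrite inE => /andP[].
apply/setP => e; rewrite !inE; case: (#|e| == r) => /=; last by rewrite andbF.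
case xe : (x \in e) => /=.
  rewrite andbT orbF; case: (e \in F) => //=; apply/forall_inP => f fF.
  by apply/set0Pn; exists x; rewrite inE xe xF.
suff -> : e \notin F by rewrite andbF.
by apply/negP => /xF; rewrite xe.
Qed.

Lemma disjoint_star_bad x F : [disjoint star r x :\: F & bad x F].
Proof.
rewrite disjoints_subset; apply/subsetP => e; rewrite !inE => /andP[_ /andP[_ ->]].
by rewrite andbF.
Qed.

Lemma card_star_setD x F : F \subset star r x -> #|star r x :\: F| = (N - #|F|)%N.
Proof. by move=> sF; rewrite cardsD (setIidPr sF) card_star. Qed.

Lemma card_avail_star x F : F \subset star r x ->
  #|avail r F| = (N - #|F| + #|bad x F|)%N.
Proof.
move=> sF; rewrite (avail_star sF) cardsU disjoint_setI0 ?disjoint_star_bad //.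
by rewrite cards0 subn0 card_star_setD.
Qed.

Lemma sum_avail_star x F (f : {set 'I_n} -> rat) : F \subset star r x ->
  \sum_(e in avail r F) f e = \sum_(e in star r x :\: F) f e + \sum_(e in bad x F) f e.
Proof.
move=> sF; rewrite (avail_star sF) -bigU ?disjoint_star_bad //.
by apply: eq_bigl => e; rewrite inE.
Qed.

Lemma bad_setU1 x F e : bad x (e |: F) = [set T in bad x F | T :&: e != set0].
Proof.
apply/setP => T; rewrite !inE -!andbA; congr [&& _, _ & _].
apply/forall_inP/andP => [h|[/forall_inP h Te] f].
  split; last by apply: h; rewrite !inE eqxx.
  by apply/forall_inP => f fF; apply: h; rewrite !inE fF orbT.
by rewrite !inE => /orP[/eqP->|/h].
Qed.

Lemma sub_star_setU1 x F e : F \subset star r x -> e \in star r x :\: F ->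
  (e |: F \subset star r x) /\ #|e |: F| = #|F|.+1.
Proof.
move=> sF; rewrite inE => /andP[eF eS].
by rewrite cardsU1 eF; split=> //; rewrite subUset sF sub1set eS.
Qed.

(** Every later choice stays in the star until it is exhausted, and the fuel outlasts its remaining
    members. *)
Lemma pstar_bad0 x k F : F \subset star r x -> bad x F = set0 -> (N < k + #|F|)%N ->
  pstar k F = 1.
Proof.
elim: k F => [|k IHk] F sF b0 ltk.
  by have := subset_leq_card sF; rewrite card_star // leqNgt ltk.
have [A0|A0] := eqVneq (avail r F) set0.
  rewrite /= A0 eqxx; suff -> : #|F| = N by rewrite eqxx.
  apply/eqP; rewrite eqn_leq; apply/andP; split.
    by have := subset_leq_card sF; rewrite card_star.
  by have /eqP := card_avail_star sF; rewrite A0 cards0 b0 cards0 addn0 eq_sym subn_eq0.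
rewrite pstar_step // (eq_bigr (fun=> 1)) => [|e].
  by rewrite sumr_const mulVf // pnatr_eq0 cards_eq0.
rewrite (avail_star sF) b0 setU0 => eS; have [sF' cF'] := sub_star_setU1 sF eS.
apply: IHk => //; last by rewrite cF' addnS -addSn.
by apply/setP => T; rewrite bad_setU1 b0 !inE.
Qed.

(** A bad [T] remains bad only if the new set meets it, and at most [r * L] members of the star
    do. *)
Lemma sum_card_bad_le x F : (1 < r)%N ->
  (\sum_(e in star r x :\: F) #|bad x (e |: F)| <= #|bad x F| * (r * L))%N.
Proof.
move=> r_gt1; rewrite -sum_nat_const.
under eq_bigr => e _ do rewrite bad_setU1 -sum1_card big_mkcond /=.
rewrite exchange_big /= [X in (_ <= X)%N]big_mkcond /=; apply: leq_sum => T _.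
under eq_bigr => e _ do rewrite inE.
case bT : (T \in bad x F) => /=; last by rewrite big1.
move: bT; rewrite !inE => /andP[/eqP cT /andP[xT _]].
rewrite -big_mkcondr sum1dep_card -[X in (_ <= X * _)%N]cT.
apply: leq_trans (card_star_hits_le r_gt1 xT).
by apply: subset_leq_card; apply/subsetP => e; rewrite !inE setIC => /andP[/andP[_ ->]].
Qed.

(** Choices outside the star are counted as failures; those inside are summed with
    [sum_card_bad_le]. *)
Lemma pstar_ge_star x k F (w : rat) : (1 < r)%N -> F \subset star r x -> avail r F != set0 ->
  0 <= w ->
  (forall e, e \in star r x :\: F -> 1 - pstar k (e |: F) <= w * #|bad x (e |: F)|%:R) ->
  #|avail r F|%:R^-1 * ((N - #|F|)%:R - w * #|bad x F|%:R * (r%:R * L%:R)) <= pstar k.+1 F.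
Proof.
move=> r_gt1 sF A0 w0 hw; rewrite pstar_step // ler_wpM2l ?invr_ge0 //.
rewrite (sum_avail_star _ sF).
apply: le_trans (_ : \sum_(e in star r x :\: F) pstar k (e |: F) <= _); last first.
  by rewrite lerDl sumr_ge0 // => e _; apply: pstar_ge0.
rewrite lerBlDr -lerBlDl -(card_star_setD sF).
have -> : #|star r x :\: F|%:R = \sum_(e in star r x :\: F) 1 :> rat by rewrite sumr_const.
rewrite -sumrB; apply: le_trans (ler_sum _ hw) _.
rewrite -mulr_sumr -mulrA ler_wpM2l // -natr_sum -!natrM ler_nat.
exact: sum_card_bad_le.
Qed.

(* Before half of the star is used, each bad set survives a step with
   probability at most 1/2, so the chance of ever leaving the star, per bad set,
   satisfies [w i = 2 / N + w i.+1 / 2] with [w h = 1] at [h = N / 2]. *)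
Lemma fail_le_bad x h k F : (1 < r)%N -> (h.*2 <= N)%N -> (4 * (r * L) <= N)%N ->
  F \subset star r x -> (#|F| <= h)%N -> (N < k + #|F|)%N ->
  1 - pstar k F <= (4%:R / N%:R + 2%:R ^+ #|F| / 2%:R ^+ h) * #|bad x F|%:R.
Proof.
move=> r_gt1 leh ler; move: {2}(h - #|F|)%N (erefl (h - #|F|)%N) => d.
elim: d k F => [|d IHd] k F ed sF lem ltk.
  have -> : #|F| = h by apply/eqP; rewrite eqn_leq lem -subn_eq0 ed.
  (* At [#|F| = h] the weight is at least 1, so the bound is trivial as soon as one bad set
     remains. *)
  have [b0|b0] := eqVneq (bad x F) set0; first by rewrite (pstar_bad0 sF b0 ltk) b0 cards0 mulr0 subrr.
  have c1 : 1 <= #|bad x F|%:R :> rat by rewrite ler1n card_gt0.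
  have p0 := @pstar_ge0 n r k F.
  have q0 : 0 <= 4%:R / N%:R :> rat by rewrite divr_ge0.
  rewrite divff ?expf_neq0 //.
  have : 1 * 1 <= (4 / N%:R + 1) * #|bad x F|%:R :> rat by apply: ler_pM => //; lra.
  by lra.
have lth : (#|F| < h)%N by rewrite -subn_gt0 ed.
have ltN : (#|F| < N)%N by move: #|F| lth => i lth; clear -lth leh; lia.
case: k ltk => [|k] ltk; first by move: ltk; rewrite add0n ltnNge (ltnW ltN).
have cA := card_avail_star sF.
have A0 : avail r F != set0.
  by rewrite -card_gt0 cA; move: #|F| ltN => i ltN; clear -ltN; lia.
have := pstar_ge_star (w := 4%:R / N%:R + 2%:R ^+ #|F|.+1 / 2%:R ^+ h) (k := k) r_gt1 sF A0.
have N0 : 0 < N%:R :> rat by rewrite ltr0n; apply: leq_ltn_trans ltN.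
have h0 : 0 < 2%:R ^+ h :> rat by rewrite exprn_gt0.
have hw : 0 <= 4%:R / N%:R + 2%:R ^+ #|F|.+1 / 2%:R ^+ h :> rat.
  by rewrite addr_ge0 // divr_ge0 // ?exprn_ge0 // ltW.
move=> /(_ hw) IH; have {IH}/IH : forall e, e \in star r x :\: F ->
    1 - pstar k (e |: F) <= (4%:R / N%:R + 2%:R ^+ #|F|.+1 / 2%:R ^+ h) * #|bad x (e |: F)|%:R.
  move=> e eS; have [sF' cF'] := sub_star_setU1 sF eS.
  have := IHd k (e |: F); rewrite cF'; apply => //.
    by rewrite subnS ed.
  by rewrite addnS -addSn.
have Npos : 0 < #|avail r F|%:R :> rat by rewrite ltr0n card_gt0.
rewrite ler_pdivrMl //.
have -> : #|avail r F|%:R = (N - #|F|)%:R + #|bad x F|%:R :> rat by rewrite cA natrD.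
have hN : N%:R <= 2%:R * (N - #|F|)%:R :> rat.
  by rewrite -natrM ler_nat; move: #|F| lth => i lth; clear -lth leh; lia.
move: ler; rewrite -(ler_nat rat) !natrM -natrM => ler.
have b0 : 0 <= #|bad x F|%:R :> rat by [].
have q0 := @pstar_ge0 n r k.+1 F; have q1 := @pstar_le1 n r k.+1 F.
rewrite exprS.
move: hN hw N0 ler.
have : 0 <= 2%:R ^+ #|F| / 2%:R ^+ h :> rat by rewrite divr_ge0 // exprn_ge0.
rewrite -!(mulrA 2%:R).
move: (2%:R ^+ #|F| / 2%:R ^+ h) => u.
move: (pstar _ _) q0 q1 => P q0 q1.
move: (r * L)%:R (#|bad _ _|%:R) b0 ((N - #|F|)%:R) (N%:R) => R B b0 K N'.
move=> u0 hK hw N0 hR hP.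
exact: (fail_arith b0 u0 hK N0 hR hP).
Qed.

End StarPhase.

(** Of the [N - 2 + M] choices for the third set, [N - 2] stay in the star; the term with [5 / N]
    accounts for leaving it later. *)
Lemma third_set_lower (A : realFieldType) (N M R g s : A) :
  12 <= N -> 0 <= M <= g * N -> 0 <= g -> 0 <= R <= s * N -> 2 <= s * N -> 0 <= s ->
  (1 + g)^-1 - 6 * s <= (N - 2 + M)^-1 * (N - 2 - 5 / N * M * R).
Proof.
move=> N12 /andP[M0 hM] g0 /andP[R0 hR] sN s0.
have N0 : 0 < N by lra.
have D0 : 0 < N - 2 + M by lra.
have h0 : 5 / N * M * R <= 5 * s * M.
  have -> : 5 / N * M * R = 5 * M * (R / N) by field; rewrite gt_eqF.
  have hRN : R / N <= s by rewrite ler_pdivrMr.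
  have -> : 5 * s * M = 5 * M * s by ring.
  by rewrite ler_wpM2l // mulr_ge0.
have i0 : 0 < 1 + g by lra.
have iE : (1 + g) * (1 + g)^-1 = 1 by rewrite mulfV // gt_eqF.
have ig : 0 < (1 + g)^-1 by rewrite invr_gt0.
rewrite ler_pdivlMl //.
have h1 : (1 + g)^-1 * (N - 2 + M) <= N.
  rewrite ler_pdivrMl //; lra.
have sM : 0 <= s * M by rewrite mulr_ge0.
have sN12 : s * 12 <= s * N by rewrite ler_wpM2l.
lra.
Qed.

(** A lower bound on the number [M] of choices leaving the star caps the proportion of those that
    stay. *)
Lemma third_set_upper (A : realFieldType) (N M g s : A) :
  2 < N -> 0 <= g -> 0 <= s <= 1 / 2 -> g * N * (1 - 2 * s) <= M ->
  (N - 2 + M)^-1 * (N - 2) <= (1 + g)^-1 + 2 * s.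
Proof.
move=> N2 g0 /andP[s0 s2] hM.
have s1 : 0 <= 1 - 2 * s by lra.
have hM' : g * (N - 2) * (1 - 2 * s) <= M.
  apply: le_trans hM; rewrite ler_wpM2r // ler_wpM2l //; lra.
have M0 : 0 <= M by apply: le_trans hM'; rewrite !mulr_ge0 //; lra.
have D0 : 0 < N - 2 + M by lra.
have i0 : 0 < 1 + g by lra.
have iE : (1 + g) * (1 + g)^-1 = 1 by rewrite mulfV // gt_eqF.
have ig : 0 < (1 + g)^-1 by rewrite invr_gt0.
rewrite ler_pdivrMl //.
move: (1 + g)^-1 iE ig => v iE ig.
have K0 : 0 < N - 2 by lra.
move: (N - 2) K0 hM' D0 => K K0 hM' D0.
apply: (@le_trans _ _ ((K + g * K * (1 - 2 * s)) * (v + 2 * s))); last first.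
  by rewrite ler_wpM2r ?addr_ge0 ?mulr_ge0 ?(ltW ig) ?lerD2l.
have gv : g * v <= 1 by lra.
have -> : (K + g * K * (1 - 2 * s)) * (v + 2 * s)
   = K * ((1 + g) * v + 2 * s * (1 - g * v + g * (1 - 2 * s))) by ring.
rewrite iE -{1}(mulr1 K) ler_wpM2l ?(ltW K0) // lerDl mulr_ge0 ?mulr_ge0 //.
by rewrite addr_ge0 ?mulr_ge0 //; lra.
Qed.

(** Makes the geometric term of [fail_le_bad], for three sets and [h = N / 2], at most [1 / N]. The
    induction starts at 7, where 8 * 15 <= 2^7. *)
Lemma leq_mul8_exp_half m : (14 <= m)%N -> (8 * m <= 2 ^ m./2)%N.
Proof.
move=> m14; have : (8 * (2 * m./2 + 1) <= 2 ^ m./2)%N.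
  have : (7 <= m./2)%N by lia.
  elim: (m./2) => // h IHh; rewrite leq_eqVlt => /orP[/eqP<-//|lth].
  by rewrite expnS; have := IHh lth; lia.
by apply: leq_trans; lia.
Qed.

(** * The process after two sets that meet in one point *)

Section TwoSets.
Variables n r : nat.
Hypotheses (r_gt1 : (1 < r)%N) (small : (8 * (r * r) <= n)%N).
Notation N := 'C(n.-1, r.-1).
Notation L := 'C(n.-2, r.-2).
Notation pstar := (@pstar_from n r).
Notation g := (r.-1%:R ^+ 3 / n.-1%:R : rat).
Notation s := (r%:R ^+ 2 / n%:R : rat).

Let r_gt0 : (0 < r)%N. Proof. exact: ltnW. Qed.
Let n_ge32 : (32 <= n)%N. Proof. by clear -r_gt1 small; nia. Qed.
Let lt2rn : (r.*2 < n)%N. Proof. by clear -r_gt1 small; nia. Qed.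

Let N_ge : (n.-1 <= N)%N.
Proof. by apply: bin_ge; clear -r_gt1 lt2rn; lia. Qed.

Let NL : (n.-1 * L = r.-1 * N)%N. Proof. exact: bin_drop2. Qed.

Let nR : 0 < n%:R :> rat.
Proof. by rewrite ltr0n; clear -n_ge32; lia. Qed.

Let rL_le : (r * L * n <= r * r * N)%N.
Proof. by apply: bin_drop2_le; rewrite r_gt1; clear -lt2rn; lia. Qed.

Let s0 : 0 <= s. Proof. by rewrite divr_ge0 ?exprn_ge0. Qed.

Let s8 : s <= 1 / 8%:R.
Proof.
have : (8 * (r * r))%:R <= n%:R :> rat by rewrite ler_nat.
by rewrite natrM natrM ler_pdivrMr //; move: nR; move: (n%:R) (r%:R) => x y; lra.
Qed.

Let rL_s : r%:R * L%:R <= s * N%:R.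
Proof.
have -> : s * N%:R = (r * r * N)%:R / n%:R by rewrite !natrM expr2; ring.
by rewrite ler_pdivlMr // -!natrM ler_nat.
Qed.

Let two_s : 2%:R <= s * N%:R.
Proof.
have -> : s * N%:R = (r * r * N)%:R / n%:R by rewrite !natrM expr2; ring.
rewrite ler_pdivlMr // -!natrM ler_nat.
have h4 : (4 <= r * r)%N by clear -r_gt1; nia.
by apply: leq_trans (leq_mul h4 N_ge); clear -n_ge32; lia.
Qed.

(** So [g] compares the approximate number of bad third sets with the size [N] of the star. *)
Let gN : g * N%:R = (r.-1 * r.-1 * L)%:R.
Proof.
have n1 : n.-1%:R != 0 :> rat by rewrite pnatr_eq0; clear -n_ge32; lia.
have h : n.-1%:R * L%:R = r.-1%:R * N%:R :> rat by rewrite -!natrM NL.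
have -> : g * N%:R = r.-1%:R ^+ 2 * (r.-1%:R * N%:R) / n.-1%:R by ring.
by rewrite -h !natrM; field.
Qed.

Let g0 : 0 <= g. Proof. by rewrite divr_ge0 ?exprn_ge0. Qed.

Section Pair.
Variables (e1 e2 : {set 'I_n}) (x : 'I_n) (k : nat).
Hypotheses (ce1 : #|e1| = r) (ce2 : #|e2| = r) (e12 : e2 :&: e1 = [set x]).
Hypothesis fuel : (N < k + 3)%N.
Let F := e2 |: [set e1].

Let xe : (x \in e1) && (x \in e2).
Proof. by have /setP/(_ x) := e12; rewrite !inE eqxx andbC. Qed.

Let card_F : #|F| = 2%N.
Proof.
rewrite /F cards2; case: eqP => // e21; have := congr1 (fun A : {set 'I_n} => #|A|) e12.
by rewrite -e21 setIid cards1 ce2 => r1; move: r_gt1; rewrite r1.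
Qed.

Let sub_F : F \subset star r x.
Proof.
have /andP[x1 x2] := xe; apply/subsetP => e; rewrite !inE => /orP[/eqP->|/eqP->].
  by rewrite ce2 eqxx x2.
by rewrite ce1 eqxx x1.
Qed.

Let valid_F : valid r F.
Proof.
split=> [|e f eF fF].
  by apply/subsetP => e /(subsetP sub_F); rewrite inE => /andP[].
apply/set0Pn; exists x; rewrite inE.
have := subsetP sub_F e eF; have := subsetP sub_F f fF.
by rewrite !inE => /andP[_ ->] /andP[_ ->].
Qed.

(** Without [x], the sets [e1] and [e2] are disjoint, so the bounds for [hits2] apply. *)
Let bad_F : bad r x F = hits2 r [set~ x] (e1 :\ x) (e2 :\ x).
Proof.
apply/setP => T; rewrite !inE.
have -> : (T \subset [set~ x]) = (x \notin T).
  by rewrite subsetC sub1set inE.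
case xT : (x \in T); rewrite /= ?andbF //; congr (_ && _).
have hit (e : {set 'I_n}) : (T :&: (e :\ x) != set0) = (T :&: e != set0).
  suff -> : T :&: (e :\ x) = T :&: e by [].
  apply/setP => y; rewrite !inE; case: eqP => [->|//]; by rewrite xT.
rewrite !hit; apply/forall_inP/andP => [h|[h1 h2] f].
  by split; apply: h; rewrite !inE eqxx ?orbT.
by rewrite !inE => /orP[] /eqP->.
Qed.

Let card_D1 (e : {set 'I_n}) : #|e| = r -> x \in e -> #|e :\ x| = r.-1.
Proof. by move=> ce ex; have := cardsD1 x e; rewrite ce ex => ->. Qed.

Let disj : [disjoint e1 :\ x & e2 :\ x].
Proof.
rewrite -setI_eq0; apply/eqP/setP => y; have /setP/(_ y) := e12; rewrite !inE.
by case: (y \in e1); case: (y \in e2); case: (y == x).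
Qed.

Let cD1 : #|e1 :\ x| = r.-1. Proof. by apply: card_D1 => //; case/andP: xe. Qed.
Let cD2 : #|e2 :\ x| = r.-1. Proof. by apply: card_D1 => //; case/andP: xe. Qed.
Let cU : #|[set~ x]| = n.-1. Proof. by rewrite cardsC1 card_ord. Qed.
Let sU (e : {set 'I_n}) : e :\ x \subset [set~ x].
Proof. by apply/subsetP => y; rewrite !inE => /andP[]. Qed.

Let M := #|bad r x F|.

Let M_le : (M <= r.-1 * r.-1 * L)%N.
Proof.
rewrite /M bad_F; apply: leq_trans (card_hits2_le r_gt1 (sU _) (sU _) disj) _.
rewrite cD1 cD2 cU leq_mul2l; apply/orP; right; apply: leq_bin2l; clear; lia.
Qed.

(* Counts only the sets that meet each of [e1 :\ x] and [e2 :\ x] in one point. *)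
Let M_ge : ((r.-1 * r.-1 * L) * n <= M * n + r.-1 * r.-1 * (2 * r * r * L))%N.
Proof.
(* The upper index equals [n.-1 - 2 * r.-1]; this form allows a comparison with [L] by
   [bin_leq_sub]. *)
pose C' := 'C(n.-2 - (r.*2 - 3), r.-2).
have h1 : (r.-1 * r.-1 * C' <= M)%N.
  have := card_hits2_ge r_gt1 (sU e1) (sU e2) disj; rewrite cD1 cD2 cU -bad_F => h.
  by apply: leq_trans h; rewrite /C' (_ : (n.-2 - _ = n.-1 - (r.-1 + r.-1))%N) //; clear -r_gt1; lia.
have h2 : (L * n <= C' * n + 2 * r * r * L)%N.
  have letm : (r.*2 - 3 <= n.-2)%N by clear -lt2rn; lia.
  have := bin_leq_sub r.-2 letm; rewrite -/C' => h.
  have n2 : (0 < n.-2)%N by clear -n_ge32; lia.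
  rewrite -(leq_pmul2l n2); move: (L) C' h1 h => l c _ h.
  have := leq_mul h (leqnn n).
  have h3 : ((r.*2 - 3) * r.-2 * n <= 2 * r * r * n.-2)%N.
    have [r' [m [-> -> lerm]]] : exists r' m, [/\ r = r'.+2, n = m.+2 & (r' <= m)%N].
      by exists r.-2, n.-2; clear -r_gt1 n_ge32 lt2rn; split; lia.
    have -> : (r'.+2.*2 - 3 = r'.*2.+1)%N by clear; lia.
    by rewrite /=; have := leq_mul lerm (leqnn r'); clear -lerm; nia.
  have := leq_mul h3 (leqnn l).
  move: ((r.*2 - 3) * r.-2)%N (2 * r * r)%N => A B.
  have -> : (n.-2 * l * n = n.-2 * (l * n))%N by ring.
  have -> : (n.-2 * (c * n + B * l) = n.-2 * c * n + B * n.-2 * l)%N by ring.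
  have -> : ((n.-2 * c + A * l) * n = n.-2 * c * n + A * n * l)%N by ring.
  by clear; move: (n.-2 * (l * n))%N (n.-2 * c * n)%N (A * n * l)%N (B * n.-2 * l)%N => *; lia.
have h1' := leq_mul h1 (leqnn n); have := leq_mul (leqnn (r.-1 * r.-1)) h2.
move: (r.-1 * r.-1)%N (2 * r * r)%N h1' => A B h1'.
have -> : (A * (L * n) = A * L * n)%N by ring.
have -> : (A * (C' * n + B * L) = A * C' * n + A * (B * L))%N by ring.
by move=> h; apply: leq_trans h _; rewrite leq_add2r.
Qed.

Let M_s : g * N%:R * (1 - 2%:R * s) <= M%:R.
Proof.
rewrite gN; have := M_ge; rewrite -(ler_nat rat) natrD.
have -> : (r.-1 * r.-1 * (2 * r * r * L))%:R = (r.-1 * r.-1 * L)%:R * (2%:R * r%:R ^+ 2) :> rat.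
  by rewrite !natrM; ring.
rewrite !(natrM _ _ n); move: (r.-1 * r.-1 * L)%:R M%:R => A B h.
rewrite -(ler_pM2r nR); have -> : A * (1 - 2%:R * s) * n%:R = A * n%:R - A * (2%:R * r%:R ^+ 2).
  by field; rewrite gt_eqF.
by rewrite lerBlDr.
Qed.

Let card_avail_F : #|avail r F|%:R = N%:R - 2%:R + M%:R :> rat.
Proof.
rewrite (card_avail_star r_gt0 sub_F) card_F natrD natrB //.
by apply: leq_trans N_ge; clear -n_ge32; lia.
Qed.

Let avail_F0 : avail r F != set0.
Proof.
rewrite -card_gt0 (card_avail_star r_gt0 sub_F) card_F.
by move: N_ge #|bad _ _ _|; move: N => N' N_ge' m; clear -N_ge' n_ge32; lia.
Qed.

Let NR : 30%:R <= N%:R :> rat.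
Proof. by rewrite ler_nat; apply: leq_trans N_ge; clear -n_ge32; lia. Qed.

(** A bad third set removes the only common point [x] and contributes 0; the other choices
    contribute at most 1. *)
Let pair_upper : pstar k.+1 F <= (1 + g)^-1 + 2%:R * s.
Proof.
rewrite pstar_step //.
have -> : \sum_(e in avail r F) pstar k (e |: F) = \sum_(e in star r x :\: F) pstar k (e |: F).
  rewrite (sum_avail_star _ sub_F) [X in _ + X]big1 ?addr0 // => e eb.
  apply: pstar_common0 => //.
    by apply: valid_setU1 => //; rewrite (avail_star sub_F) inE eb orbT.
  rewrite !common_setU1 -[[set e1]]setU0 common_setU1 common0 setTI setIC.
  rewrite (setIC e1) e12; apply/setP => y; rewrite !inE.
  case: eqP => [->|//]; rewrite ?andbT ?andbF //.
  by move: eb; rewrite !inE => /andP[_ /andP[/negbTE->]].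
apply: le_trans (_ : #|avail r F|%:R^-1 * (N%:R - 2%:R) <= _).
  rewrite ler_wpM2l ?invr_ge0 //.
  apply: (@le_trans _ _ (\sum_(e in star r x :\: F) 1)).
    by apply: ler_sum => e _; apply: pstar_le1.
  rewrite sumr_const (card_star_setD r_gt0 sub_F) card_F natrB //.
  by apply: leq_trans N_ge; clear -n_ge32; lia.
rewrite card_avail_F; apply: third_set_upper g0 _ M_s.
  by move: NR; move: N%:R => z; lra.
by rewrite s0 /=; move: s8; move: s => z; lra.
Qed.

(** After a third set in the star, [fail_le_bad] with [h = N / 2] bounds the failure probability by
    [5 / N] per bad set. *)
Let pair_lower : (1 + g)^-1 - 6%:R * s <= pstar k.+1 F.
Proof.
have N0 : 0 < N%:R :> rat by move: NR; move: N%:R => z; lra.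
have w0 : 0 <= 5%:R / N%:R :> rat by rewrite divr_ge0 // ltW.
have := pstar_ge_star (k := k) r_gt0 r_gt1 sub_F avail_F0 w0.
rewrite card_F -/M => h; apply: le_trans (h _) => [|e eS].
  rewrite card_avail_F natrB; last by apply: leq_trans N_ge; clear -n_ge32; lia.
  apply: third_set_lower => //.
  - by move: NR; move: N%:R => z; lra.
  - by rewrite ler0n gN ler_nat M_le.
  - by rewrite rL_s -natrM ler0n.
have [sF' cF'] := sub_star_setU1 sub_F eS; rewrite card_F in cF'.
have h14 : (30 <= N)%N by apply: leq_trans N_ge; clear -n_ge32; lia.
have hh : (N./2.*2 <= N)%N by move: N => z; clear; lia.
have h4 : (4 * (r * L) <= N)%N.
  have n0 : (0 < n)%N by clear -n_ge32; lia.
  rewrite -(leq_pmul2l n0); have := rL_le; have := leq_mul small (leqnn N).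
  have -> : (n * (4 * (r * L)) = 4 * (r * L * n))%N by ring.
  by move: N (r * r)%N (r * L * n)%N => a b c; clear; nia.
have h3 : (#|e |: F| <= N./2)%N by rewrite cF'; move: N h14 => z h14; clear -h14; lia.
apply: le_trans (fail_le_bad r_gt0 r_gt1 hh h4 sF' h3 _) _; first by rewrite cF'.
rewrite ler_wpM2r // cF'.
have h8 : 2%:R ^+ 3 / 2%:R ^+ (N./2) <= 1 / N%:R :> rat.
  rewrite ler_pdivrMr ?exprn_gt0 // mulrC mulrA mulr1 ler_pdivlMr // -!natrX -natrM ler_nat.
  by apply: leq_mul8_exp_half; apply: leq_trans h14.
move: h8 N0; move: (2%:R ^+ 3 / _) => z h8 N0.
have -> : 5%:R / N%:R = 4%:R / N%:R + 1 / N%:R :> rat by ring.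
by lra.
Qed.

Lemma pair_close : `|pstar k.+1 F - (1 + g)^-1| <= 6%:R * s.
Proof.
rewrite ler_norml; move: pair_upper pair_lower s0.
by move: (pstar _ _) ((1 + g)^-1) s => P v z; lra.
Qed.

End Pair.
End TwoSets.

(** * The first two choices and the estimate for all [r] *)

Section Main.
Variables n r : nat.
Notation N := 'C(n.-1, r.-1).
Notation L := 'C(n.-2, r.-2).
Notation pstar := (@pstar_from n r).
Notation g := (r.-1%:R ^+ 3 / n.-1%:R : rat).
Notation s := (r%:R ^+ 2 / n%:R : rat).

Let g0 : 0 <= g. Proof. by rewrite divr_ge0 ?exprn_ge0. Qed.
Let s0 : 0 <= s. Proof. by rewrite divr_ge0 ?exprn_ge0. Qed.

Let v01 : 0 <= (1 + g)^-1 <= 1.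
Proof.
have : 1 <= 1 + g by rewrite lerDl.
by move: (1 + g) => z z1; rewrite invr_ge0 invf_le1; lra.
Qed.

Let dist_le1 k F : `|pstar k F - (1 + g)^-1| <= 1.
Proof.
rewrite ler_norml; have := pstar_ge0 r k F; have := pstar_le1 r k F; move: v01.
by move: (pstar k F) (1 + g)^-1 => P v; lra.
Qed.

Lemma avail0 : avail r (set0 : {set {set 'I_n}}) = rsets n r.
Proof.
apply/setP => e; rewrite !inE; case: (_ == r) => //=.
by apply/forall_inP => f; rewrite inE.
Qed.

Lemma rsets_neq0 : (r <= n)%N -> rsets n r != set0.
Proof. by move=> lern; rewrite -card_gt0 card_rsets bin_gt0. Qed.

(** [pair_close] gives error [6 s] when the second set meets [e1] in one point. The exceptional
    second sets number at most [r * r * L] among at least [r * N / 3], which adds [3 s]. *)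
Let single_close (e1 : {set 'I_n}) k : (1 < r)%N -> (8 * (r * r) <= n)%N -> #|e1| = r ->
  (N < k + 3)%N -> `|pstar k.+2 [set e1] - (1 + g)^-1| <= 9%:R * s.
Proof.
move=> r_gt1 small ce1 fuel.
have r_gt0 := ltnW r_gt1.
have n_ge32 : (32 <= n)%N by clear -r_gt1 small; nia.
have vF : valid r [set e1].
  split=> [|e f]; first by rewrite sub1set inE ce1.
  by rewrite !inE => /eqP-> /eqP->; rewrite setIid -card_gt0 ce1.
have N_ge : (n.-1 <= N)%N by apply: bin_ge; clear -r_gt1 small; nia.
have A1 : (r * N <= (#|avail r [set e1]| + 1).*2)%N.
  apply: card_avail1_ge => //; rewrite ?cards1 ?r_gt0 ?leqnn //.
  by clear -r_gt1 small; nia.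
have A0 : avail r [set e1] != set0.
  rewrite -card_gt0; have := leq_mul r_gt1 N_ge; move: A1.
  by move: (r * N)%N #|_| => a b; clear -n_ge32; lia.
pose D := [set S in rsets n r | (1 < #|S :&: e1|)%N].
rewrite pstar_step //.
have s60 : 0 <= 6%:R * s by rewrite mulr_ge0.
apply: le_trans (@average_close _ _ D _ (1 + g)^-1 (6%:R * s) A0 s60 _ _) _.
- by move=> e _ _; apply: dist_le1.
- move=> e /in_avail[ce _ /(_ e1)]; rewrite inE eqxx => /(_ isT) h.
  rewrite !inE ce eqxx -leqNgt /= => h1.
  have /cards1P[x ex] : #|e :&: e1| == 1%N by rewrite eqn_leq h1 card_gt0.
  exact: (pair_close r_gt1 small ce1 ce ex fuel).
have hD : (#|D| <= r * r * L)%N by have := card_meet2_le e1 r_gt1; rewrite ce1.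
have nR : 0 < n%:R :> rat by rewrite ltr0n; clear -n_ge32; lia.
have aR : 0 < #|avail r [set e1]|%:R :> rat by rewrite ltr0n card_gt0.
suff h : #|D|%:R / #|avail r [set e1]|%:R <= 3%:R * s.
  by move: h; move: (_ / _) s => y z; lra.
rewrite ler_pdivrMr //.
have -> : 3%:R * s * #|avail r [set e1]|%:R = (3 * (r * r) * #|avail r [set e1]|)%:R / n%:R :> rat.
  by rewrite !natrM; ring.
rewrite ler_pdivlMr // -natrM ler_nat.
have h1 : (r * L * n <= r * r * N)%N.
  by apply: bin_drop2_le; rewrite r_gt1; clear -small r_gt1; nia.
have h2 : (6 <= r * N)%N.
  by apply: leq_trans (leq_mul r_gt1 N_ge); clear -n_ge32; lia.
have h3 : (r * N <= 3 * #|avail r [set e1]|)%N.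
  by move: A1 h2; move: (r * N)%N #|_| => a b; clear; lia.
apply: leq_trans (leq_mul hD (leqnn n)) _.
have -> : (r * r * L * n = r * (r * L * n))%N by ring.
apply: leq_trans (leq_mul (leqnn r) h1) _.
have -> : (r * (r * r * N) = r * r * (r * N))%N by ring.
have -> : (3 * (r * r) * #|avail r [set e1]| = r * r * (3 * #|avail r [set e1]|))%N by ring.
by rewrite leq_mul2l h3 orbT.
Qed.

Theorem prob_star_close : (0 < r)%N -> (r.*2 < n)%N ->
  `|prob_star_rat n r - (1 + g)^-1| <= 9%:R * s.
Proof.
move=> r_gt0 lt2rn.
have lern : (r <= n)%N by clear -lt2rn; lia.
have A0 : avail r (set0 : {set {set 'I_n}}) != set0 by rewrite avail0 rsets_neq0.
have s90 : 0 <= 9%:R * s by rewrite mulr_ge0.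
have [r1|r_gt1] := leqP r 1.
  have {}r1 : r = 1%N by apply/eqP; rewrite eqn_leq r1 r_gt0.
  suff -> : prob_star_rat n r = 1.
    have -> : g = 0 by rewrite r1 expr0n mul0r.
    by rewrite addr0 invr1 subrr normr0.
  rewrite /prob_star_rat pstar_step // (eq_bigr (fun=> 1)) => [|e].
    by rewrite sumr_const mulVf // pnatr_eq0 cards_eq0.
  rewrite avail0 inE r1 => /cards1P[x ex]; rewrite setU0.
  apply: (@pstar_bad0 n 1 _ x) => //.
  - by rewrite sub1set !inE ex cards1 inE !eqxx.
  - apply/setP => T; rewrite !inE; apply/negbTE; rewrite !negb_and negbK.
    case: cards1P => //= -[y ->]; rewrite inE.
    case: eqP => //= xy; apply/forall_inPn; exists e; rewrite ?inE // negbK ex.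
    by apply/eqP/setP => z; rewrite !inE; case: eqP => // ->; apply/negbTE/eqP => yx; case: xy.
  - by rewrite bin0 bin1 cards1; clear -lt2rn; lia.
(* For [n < 8 r^2] the right-hand side exceeds 1 and the bound is trivial. *)
have [small|big] := leqP (8 * (r * r))%N n; last first.
  apply: le_trans (dist_le1 _ _) _.
  have nR : 0 < n%:R :> rat by rewrite ltr0n; clear -lt2rn; lia.
  have -> : 9%:R * s = (9 * (r * r))%:R / n%:R :> rat by rewrite !natrM; ring.
  by rewrite ler_pdivlMr // mul1r ler_nat; clear -big; lia.
have Cn : (n <= 'C(n, r))%N by apply: bin_ge; clear -lt2rn r_gt0; lia.
have N_le : (N <= 'C(n, r))%N.
  have n0 : (0 < n)%N by clear -lt2rn; lia.
  have := mul_bin_diag n r.-1; rewrite prednK // => e.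
  by rewrite -(leq_pmul2l n0) e leq_mul2r lern orbT.
rewrite /prob_star_rat.
have [k ek] : exists k, 'C(n, r) = k.+2.
  exists ('C(n, r)).-2; move: Cn; move: 'C(n, r) => z Cn; clear -Cn lt2rn r_gt0; lia.
rewrite ek pstar_step //.
have := @average_close _ _ set0 _ (1 + g)^-1 (9%:R * s) A0 s90 _ _.
rewrite cards0 mul0r addr0; apply=> [e _|e eA _]; first by rewrite inE.
rewrite setU0; apply: single_close => //.
  by have := in_avail eA => -[].
by move: N_le; rewrite ek; move: N => z; clear; lia.
Qed.

End Main.

End FiniteProcess.

(** * Transfer of the finite bounds to the real numbers *)

Module RealBounds.
Import Reals all_boot all_order all_algebra zify Rstruct FiniteProcess.
Set Implicit Arguments. Unset Strict Implicit. Unset Printing Implicit Defensive.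
Import Order.TTheory GRing.Theory Num.Theory.
Local Open Scope ring_scope.

(** Identifies the explicit conversion with the field embedding, for which the morphism lemmas
    hold. *)
Lemma rat_to_RE q : rat_to_R q = ratr q.
Proof.
have E z : int_to_R z = z%:~R.
  case: z => m /=; first by rewrite INRE.
  by rewrite NegzE mulrNz -[m.+1%:~R]/(m.+1%:R) -(INRE m.+1) S_INR.
by rewrite /rat_to_R !E RdivE.
Qed.

Local Open Scope R_scope.

Lemma prob_star_ge0_R n r : 0 <= prob_star n r.
Proof.
apply/RleP; rewrite /prob_star rat_to_RE ler0q; exact: pstar_ge0.
Qed.

Lemma prob_star_close_R n r : (0 < r)%coq_nat -> (2 * r < n)%coq_nat ->
  Rabs (prob_star n r - / (1 + (INR r - 1) ^ 3 / (INR n - 1))) <= 9 * (INR r ^ 2 / INR n).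
Proof.
move=> /ssrnat.ltP r0 /ssrnat.ltP lt2rn.
have lt2rn' : (r.*2 < n)%N by rewrite -mul2n.
have := prob_star_close r0 lt2rn'; rewrite -(ler_rat R).
rewrite ratr_norm rmorphB fmorphV rmorphD rmorph1 (rmorphM _ 9%:R) !fmorph_div !rmorphXn !rmorph_nat.
have -> : r.-1%:R = (INR r - 1) :> R by rewrite INRE -subn1 natrB.
have -> : n.-1%:R = (INR n - 1) :> R by rewrite INRE -subn1 natrB //; lia.
move=> /RleP; rewrite /prob_star rat_to_RE RabsE !RpowE !INRE => h.
have -> : 9 = (9%:R)%R by rewrite -INRE INR_IZR_INZ.
exact: h.
Qed.

Lemma prob_star_le_cube_R n r a : (2 * r < n)%coq_nat -> (3 <= a)%coq_nat ->
  (2 * a <= r)%coq_nat -> (4 * a * r <= n)%coq_nat -> prob_star n r <= 32 * INR n / INR a ^ 3.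
Proof.
move=> /ssrnat.ltP lt2rn /ssrnat.leP a3 /ssrnat.leP ar /ssrnat.leP an.
have r0 : (0 < r)%N by lia.
have lt2rn' : (r.*2 < n)%N by rewrite -mul2n.
have ar' : (a.*2 <= r)%N by rewrite -mul2n.
have := prob_star_le_cube r0 lt2rn' a3 ar' an; rewrite -(ler_rat R).
rewrite fmorph_div rmorphXn rmorphM !rmorph_nat.
move=> /RleP; rewrite /prob_star rat_to_RE !RpowE !INRE => h.
have -> : 32 = (32%:R)%R by rewrite -INRE INR_IZR_INZ.
exact: h.
Qed.

Lemma prob_star_le_geometric_R n r q : (0 < r)%coq_nat -> (2 * r < n)%coq_nat ->
  (36 * q * n <= r * r)%coq_nat -> prob_star n r <= INR n * (3 / 4) ^ (6 * q).
Proof.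
move=> /ssrnat.ltP r0 /ssrnat.ltP lt2rn /ssrnat.leP hq.
have lt2rn' : (r.*2 < n)%N by rewrite -mul2n.
have := prob_star_le_geometric r0 lt2rn' hq; rewrite -(ler_rat R).
rewrite rmorphM rmorphXn fmorph_div !rmorph_nat.
move=> /RleP; rewrite /prob_star rat_to_RE !RpowE !INRE => h.
have -> : 3 = (3%:R)%R by rewrite -INRE INR_IZR_INZ.
have -> : 4 = (4%:R)%R by rewrite -INRE INR_IZR_INZ.
exact: h.
Qed.

End RealBounds.

(** * Limits *)

From Stdlib Require Import Reals.
Import Lra Lia Psatz RealBounds.
Open Scope R_scope.

Lemma cube_root_ratio (m n : nat) : (0 < n)%nat ->
  (INR m / Rpower (INR n) (1 / 3)) ^ 3 = INR m ^ 3 / INR n.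
Proof.
intros Hn; assert (H : 0 < INR n) by (apply lt_0_INR; lia).
assert (E : Rpower (INR n) (1 / 3) ^ 3 = INR n).
{ rewrite <- Rpower_pow by apply exp_pos.
  rewrite Rpower_mult; replace (1 / 3 * INR 3) with 1 by (simpl; field).
  now apply Rpower_1. }
unfold Rdiv at 1; rewrite Rpow_mult_distr, pow_inv, E; reflexivity.
Qed.

Lemma eventually_INR_gt (x : R) : exists N : nat, forall n, (N <= n)%nat -> x < INR n.
Proof.
destruct (Rle_dec x 0) as [H|H].
- exists 1%nat; intros n Hn; assert (0 < INR n) by (apply lt_0_INR; lia); lra.
- destruct (INR_unbounded x) as [N HN]; exists N; intros n Hn.
  apply le_INR in Hn; lra.
Qed.

Lemma pow_lt_cancel (x y : R) (k : nat) : 0 <= y -> x ^ k < y ^ k -> x < y.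
Proof.
intros Hy H; destruct (Rlt_le_dec x y) as [|C]; auto.
assert (y ^ k <= x ^ k) by (apply pow_incr; lra); lra.
Qed.

Lemma Rabs_inv_1p_le (x y : R) : 0 <= x -> 0 <= y -> Rabs (/ (1 + x) - / (1 + y)) <= Rabs (x - y).
Proof.
intros Hx Hy.
replace (/ (1 + x) - / (1 + y)) with ((y - x) * (/ (1 + x) * / (1 + y))) by (field; lra).
rewrite Rabs_mult, Rabs_minus_sym.
rewrite <- (Rmult_1_r (Rabs (x - y))) at 2.
apply Rmult_le_compat_l; [apply Rabs_pos|].
assert (0 < / (1 + x) <= 1).
{ split; [apply Rinv_0_lt_compat; lra|]. rewrite <- Rinv_1; apply Rinv_le_contravar; lra. }
assert (0 < / (1 + y) <= 1).
{ split; [apply Rinv_0_lt_compat; lra|]. rewrite <- Rinv_1; apply Rinv_le_contravar; lra. }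
rewrite Rabs_pos_eq; nra.
Qed.

(** Replaces (r-1)^3/(n-1) by r^3/n = c_n^3 at a cost of the same order as the error term. *)
Lemma cube_ratio_shift (r n : R) : 1 <= r -> 2 * r < n ->
  Rabs ((r - 1) ^ 3 / (n - 1) - r ^ 3 / n) <= 6 * (r ^ 2 / n).
Proof.
intros Hr Hn.
assert (A : (r - 1) ^ 3 / (n - 1) <= r ^ 3 / n).
{ apply Rmult_le_reg_r with ((n - 1) * n); [nra|].
  replace ((r - 1) ^ 3 / (n - 1) * ((n - 1) * n)) with ((r - 1) ^ 3 * n) by (field; lra).
  replace (r ^ 3 / n * ((n - 1) * n)) with (r ^ 3 * (n - 1)) by (field; lra).
  assert (r ^ 2 * r <= r ^ 2 * n) by (apply Rmult_le_compat_l; nra).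
  assert (0 <= n * ((2 * r - 1) * (r - 1))) by (repeat apply Rmult_le_pos; lra).
  nra. }
assert (B : r ^ 3 / n - 6 * (r ^ 2 / n) <= (r - 1) ^ 3 / (n - 1)).
{ apply Rmult_le_reg_r with ((n - 1) * n); [nra|].
  replace ((r - 1) ^ 3 / (n - 1) * ((n - 1) * n)) with ((r - 1) ^ 3 * n) by (field; lra).
  replace ((r ^ 3 / n - 6 * (r ^ 2 / n)) * ((n - 1) * n)) with ((r ^ 3 - 6 * r ^ 2) * (n - 1)) by (field; lra).
  assert (0 <= n * (3 * r - 1)) by (apply Rmult_le_pos; lra).
  assert (0 <= r ^ 2 * (n - 2)) by (apply Rmult_le_pos; nra).
  assert (0 <= r ^ 3) by (apply pow_le; lra).
  nra. }
apply Rabs_le; lra.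
Qed.

(** A weak Bernoulli inequality; its sixth power outweighs the fifth power of [k + 1] that bounds
    [n] for large [r]. *)
Lemma four_thirds_pow (k : nat) : (INR k + 1) / 3 <= (4 / 3) ^ k.
Proof.
induction k as [|k IH]; [simpl; lra|].
assert (1 <= (4 / 3) ^ k) by (apply pow_R1_Rle; lra).
rewrite S_INR; simpl; lra.
Qed.

Lemma cube_gt (K x : R) : 1 <= K -> K < x -> K < x ^ 3.
Proof.
intros H1 H2; assert (1 < x) by lra. assert (1 < x ^ 2) by nra.
replace (x ^ 3) with (x * x ^ 2) by ring. nra.
Qed.

Section Limits.
Variable r : nat -> nat.
Hypothesis hr : exists N : nat, forall n : nat, (N <= n)%nat -> (0 < r n)%nat /\ (2 * r n < n)%nat.
Let c := fun n : nat => INR (r n) / Rpower (INR n) (1 / 3).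
Let P := fun n : nat => prob_star n (r n).

Lemma prob_star_cv (c0 : R) : 0 <= c0 -> Un_cv c c0 -> Un_cv P (/ (1 + c0 ^ 3)).
Proof.
intros Hc0 Hc.
assert (Ht : Un_cv (fun n => c n ^ 3) (c0 ^ 3)).
{ assert (H2 := CV_mult _ _ _ _ Hc (CV_mult _ _ _ _ Hc Hc)).
  replace (c0 ^ 3) with (c0 * (c0 * c0)) by ring.
  intros e He; destruct (H2 e He) as [N HN]; exists N; intros n Hn.
  replace (c n ^ 3) with (c n * (c n * c n)) by ring. now apply HN. }
assert (HT : 0 <= c0 ^ 3) by now apply pow_le.
intros eps Heps.
destruct hr as [N1 H1].
destruct (Ht (Rmin 1 (eps / 2))) as [N2 H2]; [apply Rmin_pos; lra|].
(* The errors [9 s] and [6 s] with [s < d] add up to less than [eps / 2]. *)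
set (d := eps / 30).
assert (Hd : 0 < d) by (unfold d; lra).
destruct (eventually_INR_gt ((c0 ^ 3 + 1) ^ 2 / d ^ 3)) as [N3 H3].
exists (S (N1 + N2 + N3)); intros n Hn.
destruct (H1 n) as [R1 R2]; [lia|].
assert (T := H2 n ltac:(lia)); unfold R_dist in T.
assert (H := H3 n ltac:(lia)).
unfold c in T; rewrite cube_root_ratio in T by lia.
assert (r1 : 1 <= INR (r n)) by (change 1 with (INR 1); apply le_INR; lia).
assert (rn : 2 * INR (r n) < INR n).
{ replace (2 * INR (r n)) with (INR (2 * r n)) by (rewrite mult_INR; simpl; ring). apply lt_INR; lia. }
assert (C := @prob_star_close_R n (r n) ltac:(lia) ltac:(lia)).
assert (G := cube_ratio_shift _ _ r1 rn).
assert (g0 : 0 <= (INR (r n) - 1) ^ 3 / (INR n - 1)).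
{ apply Rmult_le_pos; [apply pow_le; lra|]. left; apply Rinv_0_lt_compat; lra. }
assert (I := Rabs_inv_1p_le _ _ g0 HT).
unfold R_dist, P.
set (x := INR (r n)) in *; set (y := INR n) in *.
assert (y0 : 0 < y) by lra.
assert (S : x ^ 2 / y < d).
{ apply pow_lt_cancel with 3%nat; [lra|].
  (* Since (r^2/n)^3 = (r^3/n)^2 / n and r^3/n stays bounded, r^2/n tends to 0. *)
  replace ((x ^ 2 / y) ^ 3) with ((x ^ 3 / y) ^ 2 / y) by (field; lra).
  assert (t1 : x ^ 3 / y <= c0 ^ 3 + 1).
  { assert (Rmin 1 (eps / 2) <= 1) by apply Rmin_l. apply Rabs_def2 in T; lra. }
  assert (t0 : 0 <= x ^ 3 / y).
  { apply Rmult_le_pos; [apply pow_le; lra|]. left; now apply Rinv_0_lt_compat. }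
  assert (t2 : (x ^ 3 / y) ^ 2 <= (c0 ^ 3 + 1) ^ 2) by (apply pow_incr; lra).
  assert (d3 : 0 < d ^ 3) by now apply pow_lt.
  apply Rmult_lt_reg_r with y; [lra|].
  replace ((x ^ 3 / y) ^ 2 / y * y) with ((x ^ 3 / y) ^ 2) by (field; lra).
  apply Rle_lt_trans with (1 := t2).
  apply Rmult_lt_reg_r with (/ d ^ 3); [now apply Rinv_0_lt_compat|].
  replace (d ^ 3 * y * / d ^ 3) with y by (field; lra). exact H. }
assert (M : Rmin 1 (eps / 2) <= eps / 2) by apply Rmin_r.
set (u := prob_star n (r n)) in *; set (v := (x - 1) ^ 3 / (y - 1)) in *.
set (t := x ^ 3 / y) in *; set (s := x ^ 2 / y) in *.
assert (E : Rabs (u - / (1 + c0 ^ 3)) <= Rabs (u - / (1 + v)) + Rabs (/ (1 + v) - / (1 + c0 ^ 3))).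
{ replace (u - / (1 + c0 ^ 3)) with ((u - / (1 + v)) + (/ (1 + v) - / (1 + c0 ^ 3))) by ring.
  apply Rabs_triang. }
assert (E2 : Rabs (v - c0 ^ 3) <= Rabs (v - t) + Rabs (t - c0 ^ 3)).
{ replace (v - c0 ^ 3) with ((v - t) + (t - c0 ^ 3)) by ring. apply Rabs_triang. }
unfold d in S; lra.
Qed.

Lemma prob_star_cv_0 : cv_infty c -> Un_cv P 0.
Proof.
intros Hc eps Heps.
set (K := 1 + 864 / eps).
assert (HK : 864 / eps < K) by (unfold K; lra).
assert (HK1 : 1 <= K).
{ unfold K; assert (0 < 864 / eps) by (apply Rdiv_lt_0_compat; lra); lra. }
set (d := eps / 6912); assert (Hd : 0 < d) by (unfold d; lra).
(* In the range of large [r] the final bound is [36 ^ 5 * 729 / z], which is below [eps] once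
   [Z < z]. *)
set (Z := 36 ^ 5 * 729 / eps).
assert (HZ : 0 < Z) by (apply Rdiv_lt_0_compat; lra).
destruct hr as [N1 H1]; destruct (Hc K) as [N2 H2].
destruct (eventually_INR_gt (/ d ^ 5)) as [N3 H3].
destruct (eventually_INR_gt (36 ^ 5 * Z ^ 5)) as [N4 H4].
(* 500 exceeds 6^3, and its square exceeds 12^5 = 248832; these give [6 <= r] and [12 r <= n] in the
   first two ranges. *)
exists (500 + N1 + N2 + N3 + N4)%nat; intros n Hn.
destruct (H1 n) as [R1 R2]; [lia|].
assert (T : K < INR (r n) ^ 3 / INR n).
{ rewrite <- cube_root_ratio by lia. apply cube_gt; [assumption|]. apply H2; lia. }
specialize (H3 n ltac:(lia)); specialize (H4 n ltac:(lia)).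
assert (n500 : 500 <= INR n).
{ replace 500 with (INR 500) by (simpl; ring). apply le_INR; lia. }
assert (p0 := prob_star_ge0_R n (r n)).
unfold R_dist, P; rewrite Rminus_0_r, Rabs_pos_eq by assumption.
set (q := r n) in *; set (x := INR q) in *; set (y := INR n) in *.
assert (T' : K * y < x ^ 3).
{ apply Rmult_lt_reg_r with (/ y); [apply Rinv_0_lt_compat; lra|].
  replace (K * y * / y) with K by (field; lra). exact T. }
assert (x0 : 1 <= x) by (change 1 with (INR 1); apply le_INR; lia).
destruct (Nat.le_gt_cases (2 * (q * q)) n) as [Csmall|Cbig].
(* Range 2 r^2 <= n: with [a = q / 2 >= x / 3] the cube bound is at most 864 n/r^3, below 864/K. *)
- assert (x6 : 6 <= x).
  { destruct (Rle_lt_dec 6 x) as [|C]; [assumption|].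
    assert (x ^ 3 <= 6 ^ 3) by (apply pow_incr; lra). nra. }
  assert (q6 : (6 <= q)%nat) by (apply INR_le; replace (INR 6) with 6 by (simpl; ring); exact x6).
  assert (D1 := Nat.Div0.mul_div_le q 2).
  assert (D2 := Nat.mul_succ_div_gt q 2 ltac:(lia)).
  assert (B : prob_star n q <= 32 * INR n / INR (q / 2) ^ 3).
  { apply prob_star_le_cube_R; try lia; nia. }
  apply Rle_lt_trans with (1 := B); fold y.
  assert (a1 : x / 3 <= INR (q / 2)).
  { assert (Q : (q <= 3 * (q / 2))%nat) by lia.
    apply le_INR in Q; rewrite mult_INR in Q.
    replace (INR 3) with 3 in Q by (simpl; ring). fold x in Q; lra. }
  assert (a3 : (x / 3) ^ 3 <= INR (q / 2) ^ 3) by (apply pow_incr; lra).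
  assert (x3 : 0 < (x / 3) ^ 3) by (apply pow_lt; lra).
  apply Rle_lt_trans with (32 * y / (x / 3) ^ 3).
  { apply Rmult_le_compat_l; [lra|]. apply Rinv_le_contravar; assumption. }
  apply Rmult_lt_reg_r with (x ^ 3); [apply pow_lt; lra|].
  replace (32 * y / (x / 3) ^ 3 * x ^ 3) with (864 * y) by (field; lra).
  assert (864 < eps * K).
  { apply Rmult_lt_reg_r with (/ eps); [now apply Rinv_0_lt_compat|].
    replace (eps * K * / eps) with K by (field; lra). exact HK. }
  apply Rlt_trans with (eps * (K * y)); nra.
- destruct (Rle_lt_dec (x ^ 5) (y ^ 3)) as [Cmid|Clarge].
  (* Middle range: with [a = n / (4 * q) >= y / (6 * x)] the cube bound is at most 6912 r^3/n^2, and
     r^5 <= n^3 makes the fifth power of r^3/n^2 at most 1/n. *)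
  + assert (x12 : 12 * x <= y).
    { destruct (Rle_lt_dec (12 * x) y) as [|C]; [assumption|].
      assert (y ^ 5 <= (12 * x) ^ 5) by (apply pow_incr; lra).
      replace ((12 * x) ^ 5) with (248832 * x ^ 5) in H by ring.
      replace (y ^ 5) with (y ^ 3 * y ^ 2) in H by ring.
      assert (0 < y ^ 3) by (apply pow_lt; lra).
      assert (250000 <= y ^ 2) by nra. nra. }
    assert (q12 : (12 * q <= n)%nat).
    { apply INR_le; rewrite mult_INR; replace (INR 12) with 12 by (simpl; ring). exact x12. }
    assert (D1 := Nat.Div0.mul_div_le n (4 * q)).
    assert (D2 := Nat.mul_succ_div_gt n (4 * q) ltac:(lia)).
    set (a := (n / (4 * q))%nat) in *.
    assert (a3 : (3 <= a)%nat) by nia.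
    assert (B : prob_star n q <= 32 * INR n / INR a ^ 3).
    { apply prob_star_le_cube_R; try lia; nia. }
    apply Rle_lt_trans with (1 := B); fold y.
    assert (a1 : y / (6 * x) <= INR a).
    { assert (Q : (n <= 6 * q * a)%nat) by nia.
      apply le_INR in Q; rewrite !mult_INR in Q.
      replace (INR 6) with 6 in Q by (simpl; ring). fold x y in Q.
      apply Rmult_le_reg_r with (6 * x); [lra|].
      replace (y / (6 * x) * (6 * x)) with y by (field; lra). lra. }
    assert (z0 : 0 < y / (6 * x)) by (apply Rdiv_lt_0_compat; lra).
    assert (a4 : (y / (6 * x)) ^ 3 <= INR a ^ 3) by (apply pow_incr; lra).
    assert (z3 : 0 < (y / (6 * x)) ^ 3) by (apply pow_lt; lra).
    apply Rle_lt_trans with (32 * y / (y / (6 * x)) ^ 3).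
    { apply Rmult_le_compat_l; [lra|]. apply Rinv_le_contravar; assumption. }
    replace (32 * y / (y / (6 * x)) ^ 3) with (6912 * (x ^ 3 / y ^ 2)) by (field; lra).
    enough (x ^ 3 / y ^ 2 < d) by (unfold d in *; lra).
    apply pow_lt_cancel with 5%nat; [lra|].
    apply Rle_lt_trans with (/ y).
    { replace ((x ^ 3 / y ^ 2) ^ 5) with ((x ^ 5) ^ 3 * / y ^ 10) by (field; lra).
      replace (/ y) with ((y ^ 3) ^ 3 * / y ^ 10) by (field; lra).
      apply Rmult_le_compat_r; [left; apply Rinv_0_lt_compat; apply pow_lt; lra|].
      apply pow_incr; split; [apply pow_le; lra|assumption]. }
    assert (0 < d ^ 5) by now apply pow_lt.
    rewrite <- (Rinv_inv (d ^ 5)); apply Rinv_lt_contravar; [|exact H3].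
    apply Rmult_lt_0_compat; [now apply Rinv_0_lt_compat|lra].
  + assert (D1 := Nat.Div0.mul_div_le (q * q) (36 * n)).
    assert (D2 := Nat.mul_succ_div_gt (q * q) (36 * n) ltac:(lia)).
    set (a := (q * q / (36 * n))%nat) in *.
    assert (B : prob_star n q <= INR n * (3 / 4) ^ (6 * a)).
    { apply prob_star_le_geometric_R; try lia; nia. }
    apply Rle_lt_trans with (1 := B); fold y.
    set (z := INR a + 1).
    assert (a0 : 0 <= INR a) by apply pos_INR.
    assert (z0 : 1 <= z) by (unfold z; lra).
    assert (zz : x ^ 2 < 36 * y * z).
    { apply lt_INR in D2; rewrite !mult_INR, (S_INR a) in D2.
      replace (INR 36) with 36 in D2 by (simpl; ring). fold x y z in D2.
      replace (x ^ 2) with (x * x) by ring. exact D2. }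
    assert (y5 : 0 < y ^ 5) by (apply pow_lt; lra).
    (* From n^6 <= r^10 <= (36 n z)^5, after cancelling n^5. *)
    assert (yz : y <= 36 ^ 5 * z ^ 5).
    { assert (H : (x ^ 2) ^ 5 <= (36 * y * z) ^ 5).
      { apply pow_incr; split; [apply pow_le; lra|lra]. }
      assert (H' : (y ^ 3) ^ 2 <= (x ^ 5) ^ 2).
      { apply pow_incr; split; [apply pow_le; lra|lra]. }
      replace ((x ^ 2) ^ 5) with ((x ^ 5) ^ 2) in H by ring.
      replace ((36 * y * z) ^ 5) with (y ^ 5 * (36 ^ 5 * z ^ 5)) in H by ring.
      replace ((y ^ 3) ^ 2) with (y ^ 5 * y) in H' by ring.
      apply Rmult_le_reg_l with (y ^ 5); [assumption|lra]. }
    assert (zZ : Z < z).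
    { apply pow_lt_cancel with 5%nat; [lra|].
      apply Rmult_lt_reg_l with (36 ^ 5); [lra|]. lra. }
    assert (geo : (3 / 4) ^ (6 * a) <= 729 / z ^ 6).
    { assert (Bn : z / 3 <= (4 / 3) ^ a) by apply four_thirds_pow.
      assert (B6 : (z / 3) ^ 6 <= ((4 / 3) ^ a) ^ 6) by (apply pow_incr; lra).
      rewrite <- pow_mult, Nat.mul_comm in B6.
      replace (3 / 4) with (/ (4 / 3)) by lra. rewrite pow_inv.
      replace (729 / z ^ 6) with (/ (z / 3) ^ 6) by (field; lra).
      apply Rinv_le_contravar; [apply pow_lt; lra|assumption]. }
    apply Rle_lt_trans with (y * (729 / z ^ 6)).
    { apply Rmult_le_compat_l; [lra|assumption]. }
    assert (z6 : 0 < z ^ 6) by (apply pow_lt; lra).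
    apply Rle_lt_trans with (36 ^ 5 * z ^ 5 * (729 / z ^ 6)).
    { apply Rmult_le_compat_r; [|assumption]. left; apply Rdiv_lt_0_compat; lra. }
    replace (36 ^ 5 * z ^ 5 * (729 / z ^ 6)) with (36 ^ 5 * 729 / z) by (field; lra).
    apply Rmult_lt_reg_r with z; [lra|].
    replace (36 ^ 5 * 729 / z * z) with (eps * Z) by (unfold Z; field; lra).
    apply Rmult_lt_compat_l; lra.
Qed.

End Limits.

Theorem theorem1 (r : nat -> nat)
  (hr : exists N : nat, forall n : nat, (N <= n)%nat ->
          (0 < r n)%nat /\ (2 * r n < n)%nat) :
  let c := fun n : nat => INR (r n) / Rpower (INR n) (1 / 3) in
  let P := fun n : nat => prob_star n (r n) in
  (Un_cv c 0 -> Un_cv P 1) /\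
  (forall c0 : R, 0 < c0 -> Un_cv c c0 -> Un_cv P (1 / (1 + c0 ^ 3))) /\
  (cv_infty c -> Un_cv P 0).
Proof.
intros c P; split; [|split].
(* The limit 1 is the case [c0 = 0] of the general formula. *)
- intros Hc; replace 1 with (/ (1 + 0 ^ 3)) by field.
  apply prob_star_cv; [exact hr|lra|exact Hc].
- intros c0 H0 Hc; unfold Rdiv; rewrite Rmult_1_l.
  apply prob_star_cv; [exact hr|lra|exact Hc].
- now apply prob_star_cv_0.
Qed.
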